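(* Let $G$ be a graph with a distinguished vertex $q$, let $R=K[x_v:v\in V(G)]$ over a field $K$, and let $\mathsf A=\mathbb Z$ or $\mathsf A=\mathrm{Pic}(G)$. Let $I_G\subset R$ and $\mathbf G(G,q)$ be as in the context. For each $k\ge0$ there exists a (natural) injection $$\psi_k:\mathfrak S_{k+2}(G,q)\hookrightarrow \mathrm{syz}_k(\mathbf G(G,q))$$ (the modules $\mathrm{syz}_k(\mathbf G(G,q))$ being formed successively with respect to the sets $\mathrm{Image}(\psi_{k-1})$, as described in the context, with $\mathrm{Image}(\psi_0)=\mathbf G(G,q)$) such that: (i) for some module ordering $<_k$, the set $\mathbf G_k(G,q):=\mathrm{Image}(\psi_k)$ forms a minimal $\mathsf A$-homogeneous Gröbner basis of $(\mathrm{syz}_k(\mathbf G(G,q)),<_k)$; (ii) for $\mathcal U\in\mathfrak S_{k+2}(G,q)$ of the form $U_1\subsetneq U_2\subsetneq\cdots\subsetneq U_{k+2}=V(G)$ we have $$\mathrm{LM}(\psi_k(\mathcal U))=\mathbf x^{D(U_2\setminus U_1,\,U_1)}\,[\psi_{k-1}(\mathcal U^{(1)})].$$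
   Context: A graph is a finite connected undirected multigraph without loops; $n=|V(G)|$. $\mathrm{Div}(G)$ is the free abelian group on $V(G)$; $D(v)$ is the coefficient of $v$ in $D$; $D$ is effective if all $D(v)\ge0$, and then $\mathbf x^D=\prod_v x_v^{D(v)}$. The Laplacian of $f:V(G)\to\mathbb Z$ is $\Delta(f)=\sum_{v}\sum_{\{v,w\}\in E(G)}(f(v)-f(w))(v)$; $\mathrm{Prin}(G)$ is the image of $\Delta$, $\mathrm{Pic}(G)=\mathrm{Div}(G)/\mathrm{Prin}(G)$, and $D_1\sim D_2$ means equality in $\mathrm{Pic}(G)$. For disjoint $A,B\subseteq V(G)$, $D(A,B)=\sum_{v\in A}(\text{number of edges between }v\text{ and }B)\,(v)$. The $\mathbb Z$-grading has $\deg\mathbf x^D=\sum_vD(v)$; the $\mathrm{Pic}(G)$-grading has $\deg\mathbf x^D=[D]$. $I_G=\langle\mathbf x^{D_1}-\mathbf x^{D_2}: D_1\sim D_2\text{ effective}\rangle$. Monomial order $<$ on $R$: degree reverse lexicographic order for a fixed total ordering of the variables such that $\mathrm{dist}(w,q)<\mathrm{dist}(v,q)\Rightarrow x_w<x_v$ (graph distance). A connected $k$-flag of $(G,q)$, $1\le k\le n$, is a sequence $\mathcal U: U_1\subsetneq\cdots\subsetneq U_k=V(G)$ with $q\in U_1$ and with the induced subgraphs $G[U_i]$ and $G[U_{i+1}\setminus U_i]$ connected for $1\le i\le k-1$. (For $k>n$ there are none.) $G(\mathcal U)$ is the partial orientation of $G$ in which, for all $1\le i\le k-1$, edges between $U_i$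 and $U_{i+1}\setminus U_i$ are oriented from $U_i$ to $U_{i+1}\setminus U_i$, all other edges being unoriented. Two connected $k$-flags are equivalent if their partial orientations coincide. Fix once and for all a total order $\preceq$ on $\{U\subseteq V(G):q\in U\}$ extending reverse inclusion (so $U\supseteq V\Rightarrow U\preceq V$). For distinct connected $k$-flags, $\mathcal U\prec_k\mathcal V$ iff $U_\ell\prec V_\ell$ for the maximal $\ell\le k-1$ with $U_\ell\ne V_\ell$. $\mathfrak S_k(G,q)$ is the set of $\prec_k$-minimal elements of the equivalence classes of connected $k$-flags. For a connected $k$-flag $\mathcal U: U_1\subsetneq U_2\subsetneq\cdots\subsetneq U_k=V(G)$ of $(G,q)$ with $k\ge2$, $\mathcal U^{(1)}$ is the flag $U_2\subsetneq U_3\subsetneq\cdots\subsetneq V(G)$ (for $\mathcal U\in\mathfrak S_k(G,q)$ one has $\mathcal U^{(1)}\in\mathfrak S_{k-1}(G,q)$). $\mathbf G(G,q)=\{\mathbf x^{D(U_2\setminus U_1,U_1)}-\mathbf x^{D(U_1,U_2\setminus U_1)}: (U_1\subsetneq U_2=V(G))\in\mathfrak S_2(G,q)\}$, a subset of $I_G$. Syzygies: $F_{-1}=R$ is regarded as the free module on one symbol $[0]$; $\psi_{-1}$ sends the unique connected $1$-flag $V(G)$ to $0$, so $[\psi_{-1}(V(G))]=[0]$. $\mathrm{syz}_0(\mathbf G(G,q))=I_G\subseteq F_{-1}$. For $k\ge1$, given $\mathbf G_{k-1}(G,q)=\mathrm{Image}(\psi_{k-1})\subseteq F_{k-2}$,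 $F_{k-1}$ is the free graded $R$-module on symbols $[g]$, $g\in\mathbf G_{k-1}(G,q)$, with $\deg[g]=\deg g$, and $\mathrm{syz}_k(\mathbf G(G,q))\subseteq F_{k-1}$ is the kernel of $F_{k-1}\to F_{k-2}$, $[g]\mapsto g$. A module ordering $<_k$ on $F_{k-1}$ is a total ordering of the monomials $\mathbf x^\alpha[g]$ extending the monomial ordering $<$ on $R$ and compatible with the $R$-module structure ($<_0$ is $<$); $\mathrm{LM}$ is the leading monomial with respect to it. A Gröbner basis is minimal if no leading monomial of an element divides the leading monomial of another. *)

(* Defs.v *)
From HB Require Import structures.
From mathcomp Require Import all_boot all_order all_algebra.
From mathcomp Require Import ring_quotient boolp.
From mathcomp Require Import mpoly.

Set Implicit Arguments.
Unset Strict Implicit.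
Unset Printing Implicit Defensive.

Import GRing.Theory.
Local Open Scope ring_scope.

Definition connected_in (V : finType) (e : rel V) (A : {set V}) : bool :=
  (A != set0) &&
  [forall u in A, forall v in A,
    connect [rel x y | [&& x \in A, y \in A & e x y]] u v].

(* A finite multigraph on V, given by its edge multiplicities. *)
Record multigraph (V : finType) := Multigraph {
  mult : V -> V -> nat;
  mult_sym : forall v w, mult v w = mult w v;
  mult_loopless : forall v, mult v v = 0%N;
  mult_connected : connected_in (fun v w => (0 < mult v w)%N) [set: V]
}.

Definition adj (V : finType) (G : multigraph V) : rel V :=
  fun v w => (0 < mult G v w)%N.

(* Length of a shortest path; in a connected graph it is less than #|V|, so
   that [find] succeeds, and the index it returns is the length itself. *)
Definition dist (V : finType) (G : multigraph V) (u v : V) : nat :=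
  find (fun d => [exists p : d.-tuple V, path (adj G) u p && (last u p == v)])
       (iota 0 #|V|).

(** Divisors, Picard group *)

Definition divisor (V : finType) := {ffun V -> int}.

Definition effective (V : finType) (D : divisor V) : Prop :=
  forall v, 0 <= D v.

Definition laplacian (V : finType) (G : multigraph V) (f : V -> int)
  : divisor V :=
  [ffun v => \sum_w (mult G v w)%:Z * (f v - f w)].

Definition prin (V : finType) (G : multigraph V) : {pred divisor V} :=
  fun D => `[< exists f, D = laplacian G f >].

Lemma prin_zmod_closed (V : finType) (G : multigraph V) :
  zmod_closed (prin G).
Proof.
split=> [|D1 D2 /asboolP[f1 ->] /asboolP[f2 ->]]; apply/asboolP.
  exists (fun=> 0); apply/ffunP=> v; rewrite !ffunE big1 // => w _.
  by rewrite subrr mulr0.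
exists (fun v => f1 v - f2 v); apply/ffunP=> v.
rewrite !ffunE -sumrB; apply: eq_bigr => w _.
by rewrite -mulrBr !opprD addrACA.
Qed.

HB.instance Definition _ (V : finType) (G : multigraph V) :=
  GRing.isZmodClosed.Build (divisor V) (prin G) (prin_zmod_closed G).

Definition Pic (V : finType) (G : multigraph V) : zmodType :=
  Quotient.quot (prin G : zmodClosed (divisor V)).

Definition pic (V : finType) (G : multigraph V) (D : divisor V) : Pic G :=
  (\pi_(Quotient.quot (prin G : zmodClosed (divisor V))) D)%qT.

(* D(A, B) *)
Definition cut_div (V : finType) (G : multigraph V) (A B : {set V})
  : divisor V :=
  [ffun v => if v \in A then (\sum_(w in B) mult G v w)%:Z else 0].

(** Monomials and polynomials: the variable x_v is 'X_(enum_rank v). *)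

Definition monom (V : finType) := 'X_{1..#|V|}.

Definition expo (V : finType) (m : monom V) (v : V) : nat := m (enum_rank v).

(* The exponent of x^D; only meaningful for D effective. *)
Definition mon_of_div (V : finType) (D : divisor V) : monom V :=
  [multinom `|D (enum_val i)|%N | i < #|V|].

Definition div_of_mon (V : finType) (m : monom V) : divisor V :=
  [ffun v => (expo m v)%:Z].

Notation polyring K V := {mpoly K[#|V|]}.

(* x^D *)
Definition xdiv (K : fieldType) (V : finType) (D : divisor V) : polyring K V :=
  'X_[mon_of_div D].

(* The group A of degrees is Z or Pic(G). *)
Variant grading := ZGrading | PicGrading.

Definition grading_group (V : finType) (G : multigraph V) (A : grading)
  : zmodType :=
  match A with ZGrading => int | PicGrading => Pic G end.

Definition deg_div (V : finType) (G : multigraph V) (A : grading)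
  (D : divisor V) : grading_group G A :=
  match A return grading_group G A with
  | ZGrading => \sum_v D v
  | PicGrading => pic G D
  end.

Definition deg_mon (V : finType) (G : multigraph V) (A : grading)
  (m : monom V) : grading_group G A := deg_div G A (div_of_mon m).

(* [lev v w] is x_v <= x_w. *)
Definition variable_order (V : finType) (G : multigraph V) (q : V)
  (lev : rel V) : Prop :=
  [/\ total lev, antisymmetric lev, transitive lev
    & forall v w, (dist G w q < dist G v q)%N -> lev w v && (w != v)].

Definition degrevlex_lt (V : finType) (lev : rel V) : rel (monom V) :=
  fun m1 m2 => (mdeg m1 < mdeg m2)%N ||
    ((mdeg m1 == mdeg m2) &&
     [exists v, (expo m2 v < expo m1 v)%N &&
       [forall w, (lev w v && (w != v)) ==> (expo m1 w == expo m2 w)]]).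

Definition degrevlex (V : finType) (lev : rel V) : rel (monom V) :=
  fun m1 m2 => (m1 == m2) || degrevlex_lt lev m1 m2.

(** Connected flags *)

Definition flag_step (V : finType) (G : multigraph V) : rel {set V} :=
  fun A B => [&& A \proper B, connected_in (adj G) A
               & connected_in (adj G) (B :\: A)].

(* The first condition forces k > 0. *)
Definition is_flag (V : finType) (G : multigraph V) (q : V) (k : nat)
  (U : k.-tuple {set V}) : bool :=
  [&& q \in head set0 U, sorted (flag_step G) U & last set0 U == setT].

(* G(U), as the set of pairs (v, w) such that the edges between v and w are
   oriented from v to w. *)
Definition flag_orient (V : finType) (G : multigraph V) (k : nat)
  (U : k.-tuple {set V}) : {set V * V} :=
  [set e | adj G e.1 e.2 &&
    [exists i : 'I_k, [&& (i.+1 < k)%N, e.1 \in nth set0 U i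
                        & e.2 \in nth set0 U i.+1 :\: nth set0 U i]]].

(* A total order on the sets containing q, extending reverse inclusion;
   [les] is unconstrained on the other sets. *)
Definition vertex_set_order (V : finType) (q : V) (les : rel {set V}) : Prop :=
  [/\ forall A B : {set V}, q \in A -> q \in B -> les A B || les B A,
      forall A B : {set V}, q \in A -> q \in B -> les A B -> les B A -> A = B,
      forall A B C : {set V}, q \in A -> q \in B -> q \in C ->
        les A B -> les B C -> les A C
    & forall A B : {set V}, q \in A -> q \in B -> B \subset A -> les A B].

(* The last entry of a flag is always V(G), so l need not be bounded by
   k - 1. *)
Definition flag_lt (V : finType) (les : rel {set V}) (k : nat)
  (U W : k.-tuple {set V}) : bool :=
  [exists l : 'I_k,
    [&& tnth U l != tnth W l, les (tnth U l) (tnth W l)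
      & [forall j : 'I_k, (l < j)%N ==> (tnth U j == tnth W j)]]].

(* The elements of S_k(G, q). *)
Definition min_flag (V : finType) (G : multigraph V) (q : V)
  (les : rel {set V}) (k : nat) (U : k.-tuple {set V}) : bool :=
  is_flag G q U &&
  [forall W : k.-tuple {set V},
    (is_flag G q W && (flag_orient G W == flag_orient G U))
      ==> ~~ flag_lt les W U].

Definition Sflag (V : finType) (G : multigraph V) (q : V)
  (les : rel {set V}) (k : nat) : finType :=
  {U : k.-tuple {set V} | min_flag G q les U}.

(* The divisor D(U_2 \ U_1, U_1). *)
Definition in_div (V : finType) (G : multigraph V) (k : nat)
  (U : k.-tuple {set V}) : divisor V :=
  let U1 := nth set0 U 0%N in let U2 := nth set0 U 1%N in
  cut_div G (U2 :\: U1) U1.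

(* The divisor D(U_1, U_2 \ U_1). *)
Definition out_div (V : finType) (G : multigraph V) (k : nat)
  (U : k.-tuple {set V}) : divisor V :=
  let U1 := nth set0 U 0%N in let U2 := nth set0 U 1%N in
  cut_div G U1 (U2 :\: U1).

(** Submodules and ideals *)

Definition lin_span (R : comNzRingType) (M : lmodType R) (S : M -> Prop) (x : M)
  : Prop :=
  exists2 s : seq (R * M), (forall p, p \in s -> S p.2)
                         & x = \sum_(p <- s) p.1 *: p.2.

Definition I_G (K : fieldType) (V : finType) (G : multigraph V)
  : polyring K V -> Prop :=
  lin_span (M := (polyring K V)^o) (fun r => exists D1 D2 : divisor V,
    [/\ effective D1, effective D2, pic G D1 = pic G D2
      & r = xdiv K D1 - xdiv K D2]).

(* The set G(G, q). *)
Definition cut_binomials (K : fieldType) (V : finType) (G : multigraph V)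
  (q : V) (les : rel {set V}) (r : polyring K V) : Prop :=
  exists U : Sflag G q les 2%N,
    r = xdiv K (in_div G (val U)) - xdiv K (out_div G (val U)).

(** Free modules, indexed by a finite set T of symbols *)

Notation freemod K V T := {ffun T -> (polyring K V)^o}.

(* The pair (m, t) stands for the monomial x^m [t]. *)
Notation mterm V T := (monom V * T)%type.

Definition mterm_elt (K : fieldType) (V T : finType) (a : mterm V T)
  : freemod K V T :=
  [ffun t => if t == a.2 then 'X_[a.1] else 0].

Definition in_support (K : fieldType) (V T : finType) (f : freemod K V T)
  (a : mterm V T) : bool := a.1 \in msupp (f a.2 : polyring K V).

(* [ord] is the reflexive form of the ordering. *)
Definition module_order (V T : finType) (lev : rel V)
  (ord : rel (mterm V T)) : Prop :=
  [/\ total ord, antisymmetric ord, transitive ord,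
      forall (m1 m2 : monom V) t, degrevlex lev m1 m2 -> ord (m1, t) (m2, t)
    & forall (m m1 m2 : monom V) t1 t2, ord (m1, t1) (m2, t2) ->
        ord ((m + m1)%MM, t1) ((m + m2)%MM, t2)].

(* [is_LM ord f a]: f is nonzero and a is its leading monomial. *)
Definition is_LM (K : fieldType) (V T : finType) (ord : rel (mterm V T))
  (f : freemod K V T) (a : mterm V T) : Prop :=
  in_support f a /\ forall b, in_support f b -> ord b a.

Definition LM_submodule (K : fieldType) (V T : finType)
  (ord : rel (mterm V T)) (S : freemod K V T -> Prop)
  : freemod K V T -> Prop :=
  lin_span (fun h => exists f a, [/\ S f, is_LM ord f a & h = mterm_elt K a]).

Definition is_groebner (K : fieldType) (V T : finType)
  (ord : rel (mterm V T)) (M S : freemod K V T -> Prop) : Prop :=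
  (forall f, S f -> M f) /\
  (forall h, LM_submodule ord S h <-> LM_submodule ord M h).

Definition mterm_dvd (V T : finType) (a b : mterm V T) : bool :=
  (a.2 == b.2) && (a.1 <= b.1)%MM.

Definition LM_minimal (K : fieldType) (V T : finType)
  (ord : rel (mterm V T)) (S : freemod K V T -> Prop) : Prop :=
  forall f g a b, S f -> S g -> f <> g -> is_LM ord f a -> is_LM ord g b ->
    ~~ mterm_dvd a b.

(* Homogeneity when the symbol [t] has degree [d t]. *)
Definition homogeneous_of (K : fieldType) (V T : finType) (G : multigraph V)
  (A : grading) (d : T -> grading_group G A) (f : freemod K V T)
  (c : grading_group G A) : Prop :=
  forall a, in_support f a -> deg_mon G A a.1 + d a.2 = c.

Definition homogeneous (K : fieldType) (V T : finType) (G : multigraph V)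
  (A : grading) (d : T -> grading_group G A) (f : freemod K V T) : Prop :=
  exists c, homogeneous_of d f c.

(* The degree of f when f is nonzero and homogeneous, computed on one of the
   monomials of f. *)
Definition deg_elt (K : fieldType) (V T : finType) (G : multigraph V)
  (A : grading) (d : T -> grading_group G A) (f : freemod K V T)
  : grading_group G A :=
  if [pick t | f t != 0] is Some t
  then deg_mon G A (mlead (f t : polyring K V)) + d t else 0.

(** Syzygies *)

(* [Fmod K V G q les k] is the module F_{k-1}.  Its symbols [psi_{k-1}(U)] are
   indexed by the flags U in S_{k+1}(G, q): psi_{k-1} is injective, so this
   set of indices is the image of psi_{k-1}.  In particular Fmod 0 is free of
   rank one, on the unique element of S_1(G, q). *)
Notation Fmod K V G q les k := (freemod K V (Sflag G q les k.+1)).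

(* The maps psi_0, psi_1, ... *)
Definition psi_family (K : fieldType) (V : finType) (G : multigraph V) (q : V)
  (les : rel {set V}) : Type :=
  forall k, Sflag G q les k.+2 -> Fmod K V G q les k.

Definition im_set (T M : Type) (f : T -> M) : M -> Prop :=
  fun y => exists x, f x = y.

(* r [0] in F_{-1} *)
Definition in_F0 (K : fieldType) (V : finType) (G : multigraph V) (q : V)
  (les : rel {set V}) (r : polyring K V) : Fmod K V G q les 0%N := [ffun=> r].

Definition syz (K : fieldType) (V : finType) (G : multigraph V) (q : V)
  (les : rel {set V}) (psi : psi_family K G q les) (k : nat)
  : Fmod K V G q les k -> Prop :=
  match k return Fmod K V G q les k -> Prop with
  | 0 => fun f => exists2 r, I_G G r & f = in_F0 G q les r
  | k'.+1 => fun f => \sum_U f U *: psi k' U = 0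
  end.

(* The degrees of the symbols of F_{k-1}: deg [0] = 0 and deg [g] = deg g. *)
Fixpoint symbol_deg (K : fieldType) (V : finType) (G : multigraph V) (q : V)
  (les : rel {set V}) (A : grading) (psi : psi_family K G q les) (k : nat)
  : Sflag G q les k.+1 -> grading_group G A :=
  match k return Sflag G q les k.+1 -> grading_group G A with
  | 0 => fun=> 0
  | k'.+1 => fun U => deg_elt (symbol_deg A psi (k := k')) (psi k' U)
  end.

(* Main.v *)
Require Import Defs.
From HB Require Import structures.
From mathcomp Require Import all_boot all_order all_algebra.
From mathcomp Require Import ring_quotient boolp.
From mathcomp Require Import mpoly.

(* Schreyer's algorithm, applied repeatedly to the cut binomials.  If g_W are
   the elements of a Groebner basis, then for the Schreyer order (compare the
   monomials x^m LM(g_W), break ties by the symbol W) the leading monomials of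
   the syzygies are generated by the x^m [W] with x^m in a colon ideal
     < LM(g_W') : LM(g_W) >,  W' after W, with LM(g_W) and LM(g_W')
   multiples of the same symbol.  For W = (U, T_1, T_2, ...) this means
   W' = (U', T_1, T_2, ...) with U before U' in the order on vertex sets, and
   the colon ideal of x^D(T_1\U, U) turns out to be minimally generated by the
   x^D(U\Z, Z) for which (Z, U, T_1, ...) is again a minimal flag.  This rests on
   a local description of the minimal flags: the members of a class differ by
   the order of their layers U_(i+1)\U_i, and a flag is minimal iff no layer can
   be moved upwards, past layers to which it sends no edge, to give a smaller
   flag.  The initial step, that the cut binomials form a Groebner basis of I_G,
   is a burning argument. *)

Set Implicit Arguments.
Unset Strict Implicit.
Unset Printing Implicit Defensive.

Import GRing.Theory.
Local Open Scope ring_scope.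

(** * Connected sets *)

(** Injectivity and minimality stay outside the induction: at each level they follow from
    [cut_exp_le_eq], by which no two leading monomials on the same symbol divide one another. The
    leading monomials of all levels are read off the flags, so the colon ideals are known before any
    syzygy is constructed, and the induction only has to supply elements with these leading
    monomials. It keeps them monic, so that S-pairs cancel, and homogeneous for an arbitrary
    additive degree, which treats both gradings at once. The direction of the tie-break is forced by
    the combinatorics: the exchange criterion bounds the set obtained by a move from below by [U],
    so a syzygy between [U] and [U'] over the same tail must have its leading monomial on the set
    that comes first. Division terminates because only finitely many monomials lie below a given
    one, a property of degrevlex that survives Schreyer's construction. *)

Section Connectivity.

Variables (V : finType) (e : rel V).
Hypothesis e_sym : ssrbool.symmetric e.

Implicit Types A B C D Z : {set V}.

(** Paths are replaced by closed sets: this principle and its converse [connected_intro] carry the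
    connectivity arguments on flags. *)
Lemma connected_sub A B x : connected_in e A -> x \in A -> x \in B ->
  (forall y z, y \in A -> y \in B -> z \in A -> e y z -> z \in B) ->
  A \subset B.
Proof.
case/andP=> _ /forall_inP/(_ x) cA xA xB clB; apply/subsetP=> z zA.
have /forall_inP/(_ z zA)/connectP[p pth ->] := cA xA.
elim: p x xA xB pth {cA} => //= y p IHp x xA xB /andP[/and3P[_ yA exy] pth].
by apply: IHp pth => //; apply: clB exy.
Qed.

Lemma connected_intro A x : x \in A ->
  (forall B, x \in B -> B \subset A ->
    (forall y z, y \in B -> z \in A -> e y z -> z \in B) -> A \subset B) ->
  connected_in e A.
Proof.
move=> xA clA; rewrite /connected_in; apply/andP; split.
  by apply/set0Pn; exists x.
set r := [rel _ _ | _].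
have r_sym : connect_sym r.
  by apply: sym_connect_sym => y z; rewrite /= e_sym andbCA.
have xr y : y \in A -> connect r x y.
  move=> yA; pose B := [set y in A | connect r x y].
  suff /subsetP/(_ y yA) : A \subset B by rewrite inE => /andP[].
  apply: clA.
  - by rewrite inE xA connect0.
  - by apply/subsetP=> z; rewrite inE => /andP[].
  - move=> z t; rewrite !inE => /andP[zA xz] tA ezt; rewrite tA.
    by apply: connect_trans xz (connect1 _); rewrite /= zA tA.
apply/forall_inP=> u uA; apply/forall_inP=> v vA.
by apply: connect_trans (xr v vA); rewrite r_sym; apply: xr.
Qed.

Lemma connectedU A B a b : connected_in e A -> connected_in e B ->
  a \in A -> b \in B -> e a b -> connected_in e (A :|: B).
Proof.
move=> cA cB aA bB eab.
apply: (@connected_intro _ a) => [|C aC sC clC]; first by rewrite inE aA.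
have sAC : A \subset C.
  apply: connected_sub cA aA aC _ => y z _ yC zA; apply: clC => //.
  by rewrite inE zA.
have bC : b \in C by apply: clC eab; rewrite // inE bB orbT.
rewrite subUset sAC; apply: connected_sub cB bB bC _ => y z _ yC zA.
by apply: clC => //; rewrite inE zA orbT.
Qed.

Lemma connected_exit A B : connected_in e A -> B != set0 -> B \proper A ->
  exists x y, [/\ x \in B, y \in A :\: B & e x y].
Proof.
move=> cA /set0Pn[x xB] /properP[sBA [z zA zB]]; apply: contrapT => noe.
suff /subsetP/(_ z zA) : A \subset B by rewrite (negPf zB).
apply: connected_sub cA (subsetP sBA x xB) xB _ => y t _ yB tA eyt.
by apply: contrapT => /negP tB; apply: noe; exists y, t; rewrite inE tB tA.
Qed.

Lemma component A x : x \in A ->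
  exists Z, [/\ x \in Z, Z \subset A, connected_in e Z
    & forall y z, y \in Z -> z \in A -> e y z -> z \in Z].
Proof.
move=> xA; pose P Z := [&& x \in Z, Z \subset A & connected_in e Z].
have P1 : P [set x].
  rewrite /P set11 sub1set xA; apply: (@connected_intro _ x) => [|B xB _ _].
    exact: set11.
  by rewrite sub1set.
have [Z /maxsetP[/and3P[xZ sZA cZ] maxZ] _] := maxset_exists P1.
exists Z; split=> // y z yZ zA eyz; rewrite -(maxZ (Z :|: [set z])).
- by rewrite !inE eqxx orbT.
- rewrite /P inE xZ subUset sZA sub1set zA.
  apply: connectedU cZ _ yZ (set11 z) eyz.
  apply: (@connected_intro _ z) => [|B zB _ _]; first exact: set11.
  by rewrite sub1set.
- exact: subsetUl.
Qed.

(* [Z] is the component of [q] in [A :\: D]; all the other components of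
   [A :\: D] are attached to [D]. *)
Lemma split_off A D q : connected_in e A -> connected_in e D -> D \subset A ->
  q \in A :\: D ->
  exists Z, [/\ q \in Z, Z \subset A :\: D, connected_in e Z,
    connected_in e (A :\: Z)
    & forall y z, y \in Z -> z \in A :\: D -> e y z -> z \in Z].
Proof.
move=> cA cD sDA qAD; have [Z [qZ sZ cZ clZ]] := component qAD.
exists Z; split=> //.
have /andP[/set0Pn[x xD] _] := cD.
have sub y : y \in D -> y \in A :\: Z.
  move=> yD; rewrite inE (subsetP sDA) // andbT; apply: contraL yD => yZ.
  by have := subsetP sZ y yZ; rewrite inE => /andP[].
apply: (@connected_intro _ x) => [|B xB sB clB]; first exact: sub.
have sDB : D \subset B.
  apply: connected_sub cD xD xB _ => y z _ yB zD; apply: clB => //.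
  exact: sub.
(* An edge of [A] leaving [Z] can only end in [D], which [B] contains, so [B :|: Z] is closed in
   [A]. *)
suff sAB : A \subset B :|: Z.
  apply/subsetP=> y; rewrite inE => /andP[yZ yA].
  by have := subsetP sAB y yA; rewrite inE (negPf yZ) orbF.
apply: connected_sub cA (subsetP sDA x xD) _ _ => [|y z yA].
  by rewrite inE xB.
rewrite !inE => yBZ zA eyz; case: (boolP (z \in Z)) => [|zZ].
  by rewrite orbT.
rewrite orbF; case/orP: yBZ => [yB|yZ].
  by apply: clB eyz; rewrite // inE zZ.
case: (boolP (z \in D)) => [/(subsetP sDB) // | zD].
by case/negP: zZ; apply: clZ yZ _ eyz; rewrite inE zD.
Qed.

End Connectivity.

(** * Connected flags *)

Section Flags.

Variables (V : finType) (G : multigraph V) (q : V).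

Implicit Types A B C D Z T : {set V}.

Lemma adj_sym : ssrbool.symmetric (adj G).
Proof. by move=> x y; rewrite /adj mult_sym. Qed.

Lemma connected_setT : connected_in (adj G) [set: V].
Proof. exact: mult_connected. Qed.

Lemma is_flagP k (U : k.-tuple {set V}) :
  reflect [/\ (0 < k)%N, q \in nth set0 U 0,
    forall i, (i.+1 < k)%N -> flag_step G (nth set0 U i) (nth set0 U i.+1)
    & nth set0 U k.-1 = setT]
  (is_flag G q U).
Proof.
rewrite /is_flag -nth0 -nth_last size_tuple.
apply: (iffP and3P) => [[qU /sortedP sU /eqP lU] | [_ qU sU /eqP lU]].
  split=> // [|i ltik]; last by apply: sU; rewrite size_tuple.
  by case: k U qU {sU lU} => // U; rewrite tuple0 inE.
by split=> //; apply/(sortedP set0) => i; rewrite size_tuple; apply: sU.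
Qed.

Section FlagTheory.

Variables (k : nat) (U : k.-tuple {set V}).
Hypothesis flagU : is_flag G q U.

Local Notation U_ := (nth set0 U).

Lemma flag_gt0 : (0 < k)%N. Proof. by case/is_flagP: flagU. Qed.

Lemma flag_last : U_ k.-1 = setT. Proof. by case/is_flagP: flagU. Qed.

Lemma flag_stepP i : (i.+1 < k)%N -> flag_step G (U_ i) (U_ i.+1).
Proof. by case/is_flagP: flagU => _ _ stepU _; apply: stepU. Qed.

Lemma flag_mono i j : (i <= j)%N -> (j < k)%N -> U_ i \subset U_ j.
Proof.
elim: j => [|j IHj]; first by rewrite leqn0 => /eqP->.
rewrite leq_eqVlt => /predU1P[-> // | leij] ltjk.
apply: subset_trans (IHj leij (ltnW ltjk)) _.
by case/and3P: (flag_stepP ltjk) => /proper_sub.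
Qed.

Lemma flag_sub i j x : (i <= j)%N -> (j < k)%N -> x \in U_ i -> x \in U_ j.
Proof. by move=> leij ltjk; apply: subsetP (flag_mono leij ltjk) x. Qed.

Lemma flag_mem0 i : (i < k)%N -> q \in U_ i.
Proof.
by move=> ltik; apply: (subsetP (flag_mono (leq0n i) ltik)); case/is_flagP: flagU.
Qed.

Lemma flag_connected i : (i < k)%N -> connected_in (adj G) (U_ i).
Proof.
move=> ltik; case: (ltnP i.+1 k) => [/flag_stepP/and3P[] // | leki].
have -> : i = k.-1 by rewrite -[in RHS](anti_leq (introT andP (conj ltik leki))).
by rewrite flag_last; apply: connected_setT.
Qed.

Lemma flag_layer i : (i.+1 < k)%N -> connected_in (adj G) (U_ i.+1 :\: U_ i).
Proof. by move=> /flag_stepP/and3P[]. Qed.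

Lemma flag_orientP x y :
  reflect (adj G x y /\ exists i, [/\ (i < k)%N, x \in U_ i & y \notin U_ i])
    ((x, y) \in flag_orient G U).
Proof.
rewrite inE /=; apply: (iffP andP) => -[xy].
  case/existsP=> i /and3P[ltik xU]; rewrite inE => /andP[yU _].
  by split=> //; exists i; split=> //; apply: ltnW.
case=> i [ltik xU yU]; split=> //.
have exj : exists j, y \in U_ j by exists k.-1; rewrite flag_last inE.
case: (ex_minnP exj) => -[|j] yUj minj.
  by case/negP: yU; apply: subsetP (flag_mono (leq0n i) ltik) y yUj.
have ltij : (i <= j)%N.
  rewrite leqNgt; apply: contra yU => ltji.
  exact: subsetP (flag_mono ltji ltik) y yUj.
have ltjk : (j.+1 < k)%N.
  have := minj k.-1; rewrite flag_last inE => /(_ isT).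
  by rewrite -ltnS prednK // flag_gt0.
apply/existsP; exists (Ordinal (ltnW ltjk)); rewrite /= ltjk inE yUj andbT.
rewrite (subsetP (flag_mono ltij (ltnW ltjk))) //=.
by apply/negP => /minj; rewrite ltnn.
Qed.

Lemma flag_orient_asym x y :
  (x, y) \in flag_orient G U -> (y, x) \notin flag_orient G U.
Proof.
move=> /flag_orientP[_ [i [ltik xi yi]]]; apply/negP.
case/flag_orientP=> _ [j [ltjk yj xj]].
case: (leqP i j) => [leij | /ltnW leji].
  by case/negP: xj; apply: subsetP (flag_mono leij ltjk) x xi.
by case/negP: yi; apply: subsetP (flag_mono leji ltik) y yj.
Qed.

Lemma flag_layer_unoriented i x y : (i.+1 < k)%N ->
  x \in U_ i.+1 :\: U_ i -> y \in U_ i.+1 :\: U_ i ->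
  (x, y) \notin flag_orient G U.
Proof.
rewrite !in_setD => ltik /andP[xi xi1] /andP[yi yi1]; apply/negP.
move=> /flag_orientP[_ [j [ltjk xj yj]]]; case: (leqP j i) => leij.
  by case/negP: xi; apply: subsetP (flag_mono leij (ltnW ltik)) x xj.
by case/negP: yj; apply: subsetP (flag_mono leij ltjk) y yi1.
Qed.

Lemma flag_head_unoriented x y : x \in U_ 0 -> y \in U_ 0 ->
  (x, y) \notin flag_orient G U.
Proof.
move=> x0 y0; apply/negP=> /flag_orientP[_ [j [ltjk xj /negP[]]]].
exact: subsetP (flag_mono (leq0n j) ltjk) y y0.
Qed.

End FlagTheory.

Definition no_edges A B := forall x y, x \in A -> y \in B -> ~~ adj G x y.

(** * Moving one layer of a flag upwards *)

Section Exchange.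

Variables (k : nat) (U : k.-tuple {set V}).
Hypothesis flagU : is_flag G q U.

Local Notation U_ := (nth set0 U).

Variables i j : nat.
Hypotheses (ltji : (j < i)%N) (ltik : (i.+1 < k)%N).

Let P := U_ j.+1 :\: U_ j.

Hypothesis sinkP : no_edges P (U_ i.+1 :\: U_ j.+1).

Definition exchange_fun l :=
  if (l <= j)%N then U_ l else if (l <= i)%N then U_ l.+1 :\: P else U_ l.

(* The flag in which the layer [U_(j+1) :\: U_j] is moved to the place of the
   layer [U_(i+1) :\: U_i]. *)
Definition exchange : k.-tuple {set V} :=
  Tuple (introT eqP (size_mkseq exchange_fun k)).

Lemma nth_exchange l : (l < k)%N -> nth set0 exchange l = exchange_fun l.
Proof. exact: nth_mkseq. Qed.

Let ltjk : (j.+1 < k)%N.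
Proof. by apply: leq_ltn_trans ltik; rewrite ltnW. Qed.

Let sUP l : (j < l)%N -> (l < k)%N -> P \subset U_ l.
Proof.
by move=> ltjl ltlk; apply: subset_trans (subsetDl _ _) (flag_mono flagU _ _).
Qed.

Lemma exchange_low l : (l <= j)%N -> exchange_fun l = U_ l.
Proof. by rewrite /exchange_fun => ->. Qed.

Lemma exchange_high l : (i < l)%N -> exchange_fun l = U_ l.
Proof.
move=> ltil; rewrite /exchange_fun (ltn_geF ltil).
by rewrite (ltn_geF (ltn_trans ltji ltil)).
Qed.

(** The range starts at [j], where both formulas agree because [U_ j.+1 :\: P] is [U_ j]; this is
    the base case in [exchange_connected]. *)
Lemma exchange_mid l : (j <= l <= i)%N -> exchange_fun l = U_ l.+1 :\: P.
Proof.
case/andP=> lejl leli; rewrite /exchange_fun leli.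
case: leqP => // lelj; have -> : l = j by apply/eqP; rewrite eqn_leq lelj.
rewrite /P setDDr setDv set0U; apply/esym/setIidPr.
by case/and3P: (flag_stepP flagU ltjk) => /proper_sub.
Qed.

(** Each further layer is joined by an edge to the set below it, and [sinkP] keeps the lower
    endpoint of that edge out of [P]. *)
Lemma exchange_connected l : (j <= l <= i)%N ->
  connected_in (adj G) (U_ l.+1 :\: P).
Proof.
case/andP=> /subnKC <-; elim: (l - j)%N => {l} [|d IHd].
  have lejji : (j <= j <= i)%N by rewrite leqnn ltnW.
  move=> _; rewrite addn0 -(exchange_mid lejji) /exchange_fun leqnn.
  by apply: (flag_connected flagU); rewrite ltnW.
rewrite addnS => ltli; set l := (j + d)%N in IHd ltli *.
have ltjl : (j < l.+1)%N by rewrite ltnS leq_addr.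
have ltlk : (l.+2 < k)%N by apply: leq_ltn_trans ltik.
have /and3P[prl _ cl] := flag_stepP flagU ltlk.
have [|x [y [xl yl xy]]] := connected_exit (flag_connected flagU ltlk) _ prl.
  by apply/set0Pn; exists q; apply: (flag_mem0 flagU); rewrite ltnW.
have -> : U_ l.+2 :\: P = (U_ l.+1 :\: P) :|: (U_ l.+2 :\: U_ l.+1).
  have /properP[/subsetP s1 _] := prl.
  have /subsetP s2 := sUP ltjl (ltnW ltlk).
  apply/setP=> z; rewrite !(in_setD, in_setU).
  have := introT implyP (s1 z); have := introT implyP (s2 z).
  by rewrite /P !in_setD; do !case: (z \in _).
apply: (connectedU adj_sym _ cl _ yl xy).
  by apply: IHd; apply: ltnW.
rewrite in_setD xl andbT; apply: contraL xy => /sinkP; apply.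
move: yl; rewrite !in_setD => /andP[yl1 yl2].
apply/andP; split; last exact: (flag_sub flagU (ltli : l.+2 <= i.+1)%N ltik yl2).
by apply: contra yl1; apply: (flag_sub flagU ltjl (ltnW ltlk)).
Qed.

Lemma exchange_flag : is_flag G q exchange.
Proof.
have k_gt0 := flag_gt0 flagU; apply/is_flagP; split=> // [|l ltlk|].
- by rewrite nth_exchange // /exchange_fun leq0n (flag_mem0 flagU).
- rewrite !nth_exchange ?(ltnW ltlk) //.
  case: (ltnP l j) => [ltlj | lejl].
    by rewrite !exchange_low ?(ltnW ltlj) //; apply: (flag_stepP flagU).
  case: (leqP l i) => [leli | ltil]; last first.
    by rewrite !exchange_high ?leqW //; apply: (flag_stepP flagU).
  rewrite exchange_mid ?lejl //; case: (ltngtP l i) leli => // [ltli | eqli] _.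
    have ltl2k : (l.+2 < k)%N by apply: leq_ltn_trans ltik.
    rewrite exchange_mid ?ltli ?andbT ?(leqW lejl) //.
    have /and3P[/properP[s12 [z z2 z1]] _ cD] := flag_stepP flagU ltl2k.
    have sP := sUP (lejl : j < l.+1)%N ltlk.
    have zP : z \notin P by apply: contra z1; apply: subsetP.
    apply/and3P; split.
    + apply/properP; split; first exact: setSD.
      by exists z; rewrite inE zP ?z2 //= z1.
    + by apply: exchange_connected; rewrite lejl ltnW.
    + rewrite (_ : _ :\: _ = U_ l.+2 :\: U_ l.+1) //.
      apply/setP=> t; rewrite !in_setD.
      have /subsetP/(_ t)/(introT implyP) := sP.
      by rewrite /P !in_setD; do !case: (t \in _).
  have -> : exchange_fun l.+1 = U_ l.+1 by apply: exchange_high; rewrite eqli.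
  have sP := sUP (lejl : j < l.+1)%N ltlk.
  have cP : connected_in (adj G) P by apply: flag_layer ltjk.
  apply/and3P; split.
  + have /andP[/set0Pn[z zP] _] := cP; apply/properP; split.
      exact: subsetDl.
    by exists z; [exact: (subsetP sP z zP) | rewrite in_setD zP].
  + by apply: exchange_connected; rewrite lejl eqli leqnn.
  + by rewrite setDDr setDv set0U (setIidPr sP).
- rewrite nth_exchange ?prednK // exchange_high ?(flag_last flagU) //.
  by rewrite -ltnS prednK.
Qed.

(** Only the position of [P] relative to the layers it passes changes, and by [sinkP] no edge joins
    [P] to them. *)
Lemma exchange_orient : flag_orient G exchange = flag_orient G U.
Proof.
apply/setP=> -[x y].
apply/(flag_orientP exchange_flag)/(flag_orientP flagU) => -[xy [l [ltlk]]].
  rewrite nth_exchange // => xl yl; split=> //.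
  case: (ltnP l j) => [/ltnW lelj | lejl].
    by exists l; rewrite exchange_low in xl yl.
  case: (ltnP i l) => [ltil | leli].
    by exists l; rewrite exchange_high in xl yl.
  move: xl yl; rewrite !exchange_mid ?lejl //.
  rewrite [x \in _]in_setD [y \in _]in_setD negb_and negbK.
  case/andP=> xP xl /orP[yP | yl]; last first.
    by exists l.+1; split=> //; apply: leq_ltn_trans ltik.
  exists j; have := yP; rewrite inE => /andP[yj _]; split=> //.
    exact: ltnW ltjk.
  apply: contraLR xy => xj; rewrite adj_sym; apply: sinkP yP _.
  move: xP; rewrite !inE (negPf xj) /= => ->.
  exact: (flag_sub flagU (leli : l.+1 <= i.+1)%N ltik xl).
move=> xl yl; split=> //.
case: (leqP l j) => [lelj | ltjl].
  by exists l; rewrite nth_exchange // exchange_low.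
case: (ltnP i l) => [ltil | leli].
  by exists l; rewrite nth_exchange // exchange_high.
have [xP | xP] := boolP (x \in P).
  exists i.+1; rewrite nth_exchange // exchange_high //.
  split=> //; first exact: (flag_sub flagU (leqW leli) ltik xl).
  apply: contraL xy => yi; apply: sinkP xP _; rewrite inE yi andbT.
  by apply: contra yl; apply: (flag_sub flagU ltjl ltlk).
case: l ltlk xl yl ltjl leli => // l ltlk xl yl ltjl leli.
exists l; rewrite nth_exchange ?(ltnW ltlk) //.
rewrite exchange_mid ?(ltnW leli) ?andbT //.
by rewrite [x \in _]in_setD [y \in _]in_setD xP xl negb_and yl orbT.
Qed.

End Exchange.

End Flags.

(** * A local criterion for minimal flags *)

Section MinimalFlags.

Variables (V : finType) (G : multigraph V) (q : V) (les : rel {set V}).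
Hypothesis Hles : vertex_set_order q les.

Implicit Types A B C D Z T : {set V}.

Lemma les_total A B : q \in A -> q \in B -> les A B || les B A.
Proof. by case: Hles => H _ _ _; apply: H. Qed.

Lemma les_anti A B : q \in A -> q \in B -> les A B -> les B A -> A = B.
Proof. by case: Hles => _ H _ _; apply: H. Qed.

Lemma les_trans A B C : q \in A -> q \in B -> q \in C ->
  les A B -> les B C -> les A C.
Proof. by case: Hles => _ _ H _; apply: H. Qed.

Lemma les_super A B : q \in A -> q \in B -> B \subset A -> les A B.
Proof. by case: Hles => _ _ _ H; apply: H. Qed.

(* Within an equivalence class, the layers of the flags are the same, and the
   flags differ in the order of these layers: a flag is minimal iff no
   exchange, moving one layer upwards past layers to which it sends no edge,
   makes it smaller. *)
Lemma min_flagP k (U : k.-tuple {set V}) :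
  let U_ := nth set0 U in
  reflect (is_flag G q U /\ forall i j, (j < i)%N -> (i.+1 < k)%N ->
      no_edges G (U_ j.+1 :\: U_ j) (U_ i.+1 :\: U_ j.+1) ->
      les (U_ i) (U_ i.+1 :\: (U_ j.+1 :\: U_ j)))
    (min_flag G q les U).
Proof.
move=> U_; apply: (iffP andP) => -[flagU minU]; split=> //.
  move=> i j ltji ltik noP; set P := U_ j.+1 :\: U_ j.
  have ltjk : (j.+1 < k)%N by apply: leq_ltn_trans ltik; rewrite ltnW.
  have ltik' := ltnW ltik.
  have sP : P \subset U_ i.
    exact: subset_trans (subsetDl _ _) (flag_mono flagU ltji ltik').
  have qP : q \notin P by rewrite in_setD (flag_mem0 flagU (ltnW ltjk)).
  have := les_total (flag_mem0 flagU ltik') (_ : q \in U_ i.+1 :\: P).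
  rewrite in_setD qP (flag_mem0 flagU ltik) => /(_ isT) /orP[] // lesW.
  have := forallP minU (exchange U i j).
  rewrite (exchange_flag flagU) //= (exchange_orient flagU) // eqxx.
  move/negP; case.
  have Wi : nth set0 (exchange U i j) i = U_ i.+1 :\: P.
    by rewrite nth_exchange // (exchange_mid flagU) // ltnW /=.
  (* The two flags agree above [i], so [i] is the index that decides [flag_lt]. *)
  apply/existsP; exists (Ordinal ltik'); rewrite !(tnth_nth set0) /= Wi lesW.
  apply/andP; split=> /=.
    have /andP[/set0Pn[x xP] _] := flag_layer flagU ltjk.
    apply/eqP => /setP/(_ x); rewrite in_setD xP /=.
    by rewrite (subsetP sP x xP).
  apply/forallP=> l; apply/implyP=> ltil.
  by rewrite !(tnth_nth set0) nth_exchange // exchange_high.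
apply/forallP=> W; apply/implyP=> /andP[flagW /eqP eqO].
apply/negP=> /existsP[[l ltlk] /and3P[]]; rewrite !(tnth_nth set0) /=.
set W_ := nth set0 W => neqWU lesWU /forallP eqafter.
have ltl1k : (l.+1 < k)%N.
  rewrite ltnNge; apply: contra neqWU => leklS.
  have -> : l = k.-1.
    by rewrite -[in RHS](anti_leq (introT andP (conj ltlk leklS))).
  by rewrite /W_ (flag_last flagU) (flag_last flagW).
have eqWU : W_ l.+1 = U_ l.+1.
  have := eqafter (Ordinal ltl1k); rewrite ltnSn !(tnth_nth set0).
  by move/eqP.
have sWW := flag_mono flagW (leqnSn l) ltl1k.
(* Every edge between [P] and the rest of [U_ l.+1] is oriented into [P]. The aim is to recognise
   [P] as a layer of [U]. *)
pose P := W_ l.+1 :\: W_ l.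
have cP : connected_in (adj G) P := flag_layer flagW ltl1k.
have defWl : W_ l = U_ l.+1 :\: P.
  by rewrite -eqWU setDDr setDv set0U; apply/esym/setIidPr.
have orW y z : y \in W_ l -> z \in P -> adj G y z -> (y, z) \in flag_orient G U.
  move=> yW; rewrite in_setD => /andP[zW _] yz.
  by rewrite -eqO; apply/(flag_orientP flagW); split=> //; exists l.
have exj : exists j, U_ j :&: P != set0.
  exists l.+1; rewrite -eqWU (setIidPr (subsetDl _ _)).
  by case/andP: cP.
case: (ex_minnP exj) => j /set0Pn[x]; rewrite in_setI => /andP[xUj xP] minj.
have lejl1 : (j <= l.+1)%N.
  apply: minj; rewrite -eqWU (setIidPr (subsetDl _ _)).
  by case/andP: cP.
have inW y : y \in U_ j -> y \in W_ l.+1.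
  by rewrite eqWU; apply: (flag_sub flagU lejl1 ltl1k).
(* No edge inside [U_ 0] is oriented, so if [U_ 0] met [P] it would lie in [P], together with [q];
   but [q] is in [W_ l]. *)
case: j xUj minj lejl1 inW => [|j] xUj minj lejl1 inW.
  have /subsetP/(_ q) : U_ 0 \subset P.
    apply: connected_sub (flag_connected flagU _) xUj xP _.
      exact: flag_gt0 flagU.
    move=> y z yU yP zU yz; rewrite in_setD inW // andbT.
    apply/negP=> zW; have := orW z y zW yP; rewrite adj_sym => /(_ yz).
    by apply/negP; apply: (flag_head_unoriented flagU).
  rewrite (flag_mem0 flagU (flag_gt0 flagU)) => /(_ isT).
  by rewrite in_setD (flag_mem0 flagW ltlk).
have ltj1k := leq_ltn_trans lejl1 ltl1k.
pose Q := U_ j.+1 :\: U_ j.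
have PUj y : y \in P -> y \notin U_ j.
  move=> yP; apply/negP=> yUj; have := minj j.
  rewrite ltnn => /(_ _)/negP[] //; apply/set0Pn; exists y.
  by rewrite in_setI yUj.
have xQ : x \in Q by rewrite in_setD PUj.
(* [P] and [Q] meet in [x]. Both are connected without oriented edges inside, whereas an edge by
   which one of them left the other would be oriented. *)
have sPQ : P \subset Q.
  suff /subsetP sPU : P \subset U_ j.+1.
    by apply/subsetP=> y yP; rewrite in_setD PUj ?sPU.
  apply: connected_sub cP xP xUj _ => y z yP yU zP yz.
  apply: contraT => zU; have : (y, z) \in flag_orient G W.
    by rewrite eqO; apply/(flag_orientP flagU); split=> //; exists j.+1.
  by rewrite (negPf (flag_layer_unoriented flagW ltl1k yP zP)).
have sQP : Q \subset P.
  apply: connected_sub (flag_layer flagU ltj1k) xQ xP _ => y z yQ yP zQ yz.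
  have zU : z \in U_ j.+1 by move: zQ; rewrite in_setD => /andP[].
  rewrite in_setD inW // andbT; apply/negP=> zW.
  have := orW z y zW yP; rewrite adj_sym => /(_ yz).
  by rewrite (negPf (flag_layer_unoriented flagU ltj1k zQ yQ)).
have eqPQ : P = Q by apply/eqP; rewrite eqEsubset sPQ.
have {lejl1} := lejl1; rewrite leq_eqVlt eqSS => /predU1P[eqjl | ltjl].
  case/eqP: neqWU; rewrite -/W_ defWl eqPQ /Q eqjl setDDr setDv set0U.
  by apply/setIidPr/(flag_mono flagU).
case/eqP: neqWU; apply: les_anti lesWU _.
- exact: (flag_mem0 flagW ltlk).
- exact: (flag_mem0 flagU ltlk).
(* An edge from [Q] to a later layer of [U] is oriented out of [Q] by [U], but into [P = Q] by
   [W]. *)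
rewrite -/W_ defWl eqPQ; apply: minU => // y z yQ zU; apply/negP=> yz.
have yP : y \in P by rewrite eqPQ.
have /andP[zUj zUl] : (z \notin U_ j.+1) && (z \in U_ l.+1) by rewrite -in_setD.
have zW : z \in W_ l.
  by rewrite defWl in_setD zUl andbT eqPQ in_setD (negPf zUj) andbF.
have zy : adj G z y by rewrite adj_sym.
case/negP: (flag_orient_asym flagU (orW z y zW yP zy)).
apply/(flag_orientP flagU); split=> //; exists j.+1; split=> //.
by move: yQ; rewrite in_setD => /andP[].
Qed.

Lemma is_flag_cons k (U : k.+1.-tuple {set V}) Z :
  is_flag G q [tuple of Z :: U] =
  [&& q \in Z, flag_step G Z (nth set0 U 0) & is_flag G q U].
Proof.
case/tupleP: U => A U; rewrite /is_flag /= -andbA.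
case: (boolP (q \in Z)) => //= qZ; case stZA: (flag_step G Z A) => //=.
by have /and3P[/proper_sub/subsetP->] := stZA.
Qed.

(** The criterion separates into the exchanges of the bottom layer and those of the tail. Minimal
    flags can thus be built downwards, one set at a time, and their tails are again minimal. *)
Lemma min_flag_cons k (U : k.+1.-tuple {set V}) Z :
  let U_ := nth set0 U in
  min_flag G q les [tuple of Z :: U] <->
  [/\ q \in Z, flag_step G Z (U_ 0), min_flag G q les U
    & forall i, (i < k)%N -> no_edges G (U_ 0 :\: Z) (U_ i.+1 :\: U_ 0) ->
        les (U_ i) (U_ i.+1 :\: (U_ 0 :\: Z))].
Proof.
move=> U_; split=> [/min_flagP[] | [qZ stZ /min_flagP[flagU minU] minZ]].
  rewrite is_flag_cons => /and3P[qZ stZ flagU] minZU; split=> //.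
    apply/min_flagP; split=> // i j ltji ltik; exact: (minZU i.+1 j.+1).
  by move=> i ltik; apply: (minZU i.+1 0).
apply/min_flagP; rewrite is_flag_cons qZ stZ; split=> // -[|i] [|j] // ltji ltik.
  exact: minZ.
exact: minU.
Qed.

End MinimalFlags.

(** * Cuts and colon ideals *)

Section Cuts.

Variables (V : finType) (G : multigraph V).

Implicit Types A B U T : {set V}.

Definition edges_to v A : nat := (\sum_(w in A) mult G v w)%N.

(* The exponent of [x_v] in [x^D(A,B)]. *)
Definition cut_exp A B v : nat := if v \in A then edges_to v B else 0%N.

Lemma edges_to_eq0 v A :
  (forall w, w \in A -> ~~ adj G v w) -> edges_to v A = 0%N.
Proof.
by move=> noA; apply: big1 => w /noA; rewrite /adj lt0n negbK => /eqP.
Qed.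

Lemma edges_to_gt0 v A w : w \in A -> adj G v w -> (0 < edges_to v A)%N.
Proof.
by move=> wA vw; rewrite /edges_to (bigD1 w) //= addn_gt0 [(0 < _)%N]vw.
Qed.

Lemma edges_to_le v A B : (forall w, w \in A -> adj G v w -> w \in B) ->
  (edges_to v A <= edges_to v B)%N.
Proof.
move=> sAB; rewrite /edges_to [leqLHS]big_mkcond [leqRHS]big_mkcond /=.
apply: leq_sum => w _; case: (boolP (w \in A)) => // wA.
case: (boolP (adj G v w)) => [/(sAB w wA)-> //|].
by rewrite /adj lt0n negbK => /eqP->.
Qed.

Lemma edges_toID v A B :
  edges_to v A = (edges_to v (A :&: B) + edges_to v (A :\: B))%N.
Proof. exact: big_setID. Qed.

Lemma expo_cut_div A B v :
  expo (mon_of_div (cut_div G A B)) v = cut_exp A B v.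
Proof. by rewrite /expo mnmE enum_rankK ffunE /cut_exp; case: ifP. Qed.

(** At a vertex of [U'] outside [U] with a neighbour in [U], the left exponent is positive and the
    right one zero, so [U'] lies in [U]. At a vertex of [T :\: U] with a neighbour in [U :\: U'] the
    left exponent is again the larger, so the connected set [T :\: U'] cannot reach beyond
    [T :\: U]. *)
Lemma cut_exp_le_eq T U U' q : q \in U -> q \in U' ->
  flag_step G U T -> flag_step G U' T ->
  (forall v, (cut_exp (T :\: U) U v <= cut_exp (T :\: U') U' v)%N) -> U = U'.
Proof.
move=> qU qU' /and3P[/proper_sub/subsetP sUT cU cC].
move=> /and3P[/proper_sub/subsetP sUT' cU' cC'] lec.
have sUU' : U' \subset U.
  apply: connected_sub cU' qU' qU _ => y z yU' yU zU' yz.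
  apply: contraT => zU; have := lec z.
  rewrite /cut_exp !in_setD zU zU' /= sUT' // leqNgt.
  by rewrite (edges_to_gt0 yU) // adj_sym.
apply/eqP; rewrite eqEsubset sUU' andbT.
suff /subsetP sC'C : T :\: U' \subset T :\: U.
  apply/subsetP=> z zU; apply: contraT => zU'.
  by have := sC'C z; rewrite !in_setD zU zU' sUT // => /(_ isT).
have /andP[/set0Pn[c cCc] _] := cC.
have sCC' z : z \in T :\: U -> z \in T :\: U'.
  rewrite !in_setD => /andP[zU ->]; rewrite andbT.
  by apply: contra zU; apply: (subsetP sUU').
apply: connected_sub cC' (sCC' c cCc) cCc _ => y z yC' yC zC' yz.
rewrite in_setD; move: zC'; rewrite in_setD => /andP[zU' ->]; rewrite andbT.
apply/negP=> zU; have := lec y; rewrite /cut_exp yC yC' leqNgt.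
rewrite (edges_toID y U U') (setIidPr sUU') -{1}[edges_to y U']addn0 ltn_add2l.
by rewrite (@edges_to_gt0 _ _ z) // in_setD zU' zU.
Qed.

End Cuts.

(** * Generators of the colon ideals *)

Section Colon.

Variables (V : finType) (G : multigraph V) (q : V) (les : rel {set V}).
Hypothesis Hles : vertex_set_order q les.

Variables (k : nat) (T : k.+1.-tuple {set V}).

Implicit Types U Z : {set V}.

Local Notation T_ := (nth set0 T).
Local Notation T0 := (nth set0 T 0).

(* If [U :\: Z] is adjacent to [T0 :\: U], take [U' := Z]; otherwise take
   [U' := T0 :\: (U :\: Z)]. *)
Lemma colon_generator U Z : min_flag G q les [tuple of Z :: [tuple of U :: T]] ->
  exists U', [/\ min_flag G q les [tuple of U' :: T], les U U', U <> U'
    & forall v, cut_exp G (U :\: Z) Z v =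
        (cut_exp G (T0 :\: U') U' v - cut_exp G (T0 :\: U) U v)%N].
Proof.
move/(min_flag_cons G Hles) => [qZ stZ minUT condZ].
have [qU stU minT condU] := (min_flag_cons G Hles _ _).1 minUT.
rewrite /= in stZ condZ.
have /and3P[/properP[/subsetP sZU [d dU dZ]] cZ cD] := stZ.
have /and3P[/properP[/subsetP sUT [c cT cU']] cU cC] := stU.
have flagT : is_flag G q T by case/andP: minT.
set D := U :\: Z in cD condZ *; set C := T0 :\: U in cC condU *.
have dD : d \in D by rewrite in_setD dZ.
have [/exists_inP[x xD /exists_inP[y yC xy]] | noDC] :=
  boolP [exists x in D, exists y in C, adj G x y].
  have TZ : T0 :\: Z = D :|: C.
    apply/setP=> v; rewrite in_setU !in_setD.
    have := introT implyP (sZU v); have := introT implyP (sUT v).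
    by do !case: (v \in _).
  exists Z; split.
  - apply/(min_flag_cons G Hles); split=> // [|i ltik noTZ].
      apply/and3P; split=> //.
        apply/properP; split; first by apply/subsetP=> v /sZU/sUT.
        by exists c => //; apply: contra cU'; apply: sZU.
      by rewrite TZ; apply: (connectedU (adj_sym G) cD cC xD yC xy).
    have qT := flag_mem0 flagT (ltnW (ltik : i.+1 < k.+1)%N).
    have qT1 := flag_mem0 flagT (ltik : i.+1 < k.+1)%N.
    (* Removing only [C] leaves a larger set than removing [T0 :\: Z], and [les] extends reverse
       inclusion. *)
    have lesC : les (T_ i) (T_ i.+1 :\: C).
      apply: condU => // u v uC; apply: noTZ.
      by rewrite TZ in_setU uC orbT.
    apply: (les_trans Hles) lesC _ => //.
    + by rewrite !in_setD qU.
    + by rewrite !in_setD qZ.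
    apply: (les_super Hles); rewrite ?in_setD ?qU ?qZ //.
    by apply: setDS; rewrite TZ subsetUr.
  - by apply: (les_super Hles) => //; apply/subsetP.
  - by move=> eqUZ; rewrite eqUZ (negPf dZ) in dU.
  (* The subtraction is truncated: on [D] there is nothing to subtract, and on [C] it gives 0
     because [Z] lies in [U]. *)
  - move=> v; rewrite /cut_exp TZ in_setU.
    case: (boolP (v \in D)) => [vD | vD] /=.
      move: vD; rewrite /C !in_setD => /andP[_ ->] /=.
      by rewrite subn0.
    case: (boolP (v \in C)) => // _; apply/esym/eqP; rewrite subn_eq0.
    by apply: edges_to_le => w /sZU.
have {}noDC x y : x \in D -> y \in C -> ~~ adj G x y.
  move=> xD yC; apply: contra noDC => xy.
  by apply/exists_inP; exists x => //; apply/exists_inP; exists y.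
have TD : T0 :\: (T0 :\: D) = D.
  rewrite setDDr setDv set0U; apply/setIidPr/subsetP=> v.
  by rewrite in_setD => /andP[_ /sUT].
have TDE : T0 :\: D = Z :|: C.
  apply/setP=> v; rewrite in_setU !in_setD.
  have := introT implyP (sZU v); have := introT implyP (sUT v).
  by do !case: (v \in _).
have qT0 := flag_mem0 flagT (ltn0Sn k).
exists (T0 :\: D); split.
- apply/(min_flag_cons G Hles); rewrite TD; split=> //.
  + by rewrite !in_setD qZ.
  + apply/and3P; split=> //; last by rewrite TD.
      apply/properP; split; first exact: subsetDl.
      by exists d; rewrite ?sUT // in_setD dD.
    have pU : U \proper T0 by case/and3P: stU.
    have cT0 := flag_connected flagT (ltn0Sn k).
    have [|x [y [xU yC xy]]] := connected_exit cT0 _ pU.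
      by apply/set0Pn; exists q.
    rewrite TDE; apply: (connectedU (adj_sym G) cZ cC _ yC xy).
    apply: contraLR xy => xZ; apply: noDC yC.
    by rewrite in_setD xZ.
  (* As [D] sends no edge to [C], the longer flag allows [D] to move past [C] and on through the
     same layers. *)
  + move=> i ltik noD; apply: (condZ i.+1) => // x y xD yT.
    have [yT0 | yT0] := boolP (y \in T0).
      by apply: noDC => //; move: yT; rewrite !in_setD yT0 andbT => /andP[].
    by apply: noD => //; move: yT; rewrite !in_setD yT0 => /andP[].
(* Moving [D] past [C] replaces [U] by [T0 :\: D]; minimality of the longer flag therefore puts [U]
   before [U']. *)
- exact: (condZ 0).
- move/setP/(_ d); rewrite dU TDE in_setU (negPf dZ) in_setD dU.
  by [].
- move=> v; rewrite /cut_exp TD; case: (boolP (v \in D)) => // vD.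
  have vU : v \in U by move: vD; rewrite in_setD => /andP[].
  rewrite [v \in C]in_setD vU subn0 TDE (edges_toID G v (Z :|: C) Z).
  rewrite setUK [X in (_ + X)%N]edges_to_eq0 ?addn0 // => w.
  rewrite in_setD in_setU => /andP[/negPf-> /= wC].
  exact: noDC.
Qed.

(* [Z] is the component of [q] in [U :\: D'], where [D'] is a component of
   [U :\: U'].  If no edge joins [U :\: Z] to [T0 :\: U], then [D'], [U :\: Z]
   and [T0 :\: U'] all coincide. *)
Lemma colon_divisor U U' :
  min_flag G q les [tuple of U :: T] -> min_flag G q les [tuple of U' :: T] ->
  les U U' -> U <> U' ->
  exists2 Z, min_flag G q les [tuple of Z :: [tuple of U :: T]]
    & forall v, (cut_exp G (U :\: Z) Z v <=
        cut_exp G (T0 :\: U') U' v - cut_exp G (T0 :\: U) U v)%N.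
Proof.
move=> minUT minUT' lesUU' neqUU'.
have [qU stU minT condU] := (min_flag_cons G Hles _ _).1 minUT.
have [qU' stU' _ condU'] := (min_flag_cons G Hles _ _).1 minUT'.
have /and3P[/proper_sub/subsetP sUT cU cC] := stU.
have /and3P[/proper_sub/subsetP sUT' cU' cC'] := stU'.
have flagT : is_flag G q T by case/andP: minT.
have : ~~ (U \subset U').
  apply: contra_notN neqUU' => sUU'.
  by apply: (les_anti Hles) => //; apply: (les_super Hles).
case/subsetPn=> x xU xU'.
have xUU' : x \in U :\: U' by rewrite in_setD xU'.
have [D' [xD' sD' cD' clD']] := component (adj_sym G) xUU'.
have sD'U : D' \subset U by apply: subset_trans sD' (subsetDl _ _).
have qD' : q \in U :\: D'.
  rewrite in_setD qU andbT; apply/negP=> /(subsetP sD').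
  by rewrite in_setD qU'.
have [Z [qZ sZ cZ cD clZ]] := split_off (adj_sym G) cU cD' sD'U qD'.
have [sZU sZD'] : Z \subset U /\ [disjoint Z & D'].
  by move: sZ; rewrite subsetD => /andP[].
have xZ : x \notin Z by apply/negP=> /(disjointFr sZD'); rewrite xD'.
set D := U :\: Z in cD.
have sD'D : D' \subset D by rewrite subsetD sD'U disjoint_sym.
exists Z; last first.
  (* A vertex of [D] outside [D'] has no neighbour in [Z]; for one in [D'], the neighbours in [Z]
     lie in [U'], because [D'] is a component of [U :\: U']. *)
  move=> v; rewrite /cut_exp -/D; case: (boolP (v \in D)) => // vD.
  have /andP[vZ vU] : (v \notin Z) && (v \in U) by rewrite -in_setD.
  rewrite [v \in _ :\: U]in_setD vU /= subn0.
  have [vD' | vD'] := boolP (v \in D'); last first.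
    rewrite edges_to_eq0 // => w wZ; apply: contra vZ => vw.
    apply: clZ wZ _ _; first by rewrite in_setD vD'.
    by rewrite adj_sym.
  move: (subsetP sD' v vD'); rewrite in_setD => /andP[vU' _].
  rewrite in_setD vU' sUT //=; apply: edges_to_le => w wZ vw.
  apply: contraT => wU'; have := disjointFr sZD' wZ.
  by rewrite (clD' v) // in_setD wU' (subsetP sZU).
apply/(min_flag_cons G Hles); split=> //.
  apply/and3P; split=> //; apply/properP; split=> //=.
  by exists x.
rewrite /= -/D.
have [/exists_inP[u uD /exists_inP[v vC uv]] | noDC] :=
  boolP [exists u in D, exists v in T0 :\: U, adj G u v].
  (* Every member of [T] contains [T0 :\: U], so an edge from [D] to that set makes the exchange
     conditions vacuous. *)
  move=> i ltik noD.
  suff vI : v \in T_ i :\: U by have := noD u v uD vI; rewrite uv.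
  move: vC; rewrite !in_setD => /andP[-> vT] /=.
  case: i ltik {noD} => // i ltik.
  exact: (flag_sub flagT (leq0n i.+1)).
have {}noDC u v : u \in D -> v \in T0 :\: U -> ~~ adj G u v.
  move=> uD vC; apply: contra noDC => uv.
  by apply/exists_inP; exists u => //; apply/exists_inP; exists v.
(* [T0 :\: U'] is connected and contains [x]; an edge taking it out of [D'] would have to lead to
   [T0 :\: U], where [D] sends none. *)
have sC'D' : T0 :\: U' \subset D'.
  apply: connected_sub cC' _ xD' _ => [|y z _ yD'].
    by rewrite in_setD xU' sUT.
  rewrite in_setD => /andP[zU' zT] yz; apply: (clD' y) => //.
  rewrite in_setD zU' /=; apply: contraLR yz => zU; apply: noDC.
    exact: (subsetP sD'D).
  by rewrite in_setD zU.
have sU' : U' \subset Z :|: (T0 :\: U).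
  apply: connected_sub cU' qU' _ _ => [|y z _ yZC zU' yz].
    by rewrite in_setU qZ.
  rewrite in_setU in_setD (sUT' z) // andbT.
  have [zU /= | _] := boolP (z \in U); last by rewrite orbT.
  rewrite orbF; apply: contraLR yz => zZ; rewrite adj_sym.
  have zD : z \in D by rewrite in_setD zZ.
  case/setUP: yZC => [yZ | /noDC]; last exact.
  apply: contra zZ => zy; apply: clZ yZ _ _; last by rewrite adj_sym.
  rewrite in_setD zU andbT; apply/negP=> /(subsetP sD').
  by rewrite in_setD zU'.
have DE : D = T0 :\: U'.
  apply/eqP; rewrite eqEsubset (subset_trans sC'D' sD'D) andbT.
  apply/subsetP=> y; rewrite !in_setD => /andP[yZ yU]; rewrite sUT // andbT.
  apply: contra yZ => /(subsetP sU'); rewrite in_setU in_setD yU.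
  by rewrite orbF.
(* For [i = 0] the condition is the hypothesis [les U U']; above, it comes from minimality of the
   flag with head [U'], whose first layer is [D]. *)
case=> [|i] ltik noD.
  rewrite DE setDDr setDv set0U (setIidPr _) //; exact/subsetP.
rewrite /= DE; apply: condU' => // u v; rewrite -DE => uD vT.
apply: noD => //; move: vT; rewrite !in_setD => /andP[vT ->].
by rewrite andbT; apply: contra vT; apply: sUT.
Qed.

End Colon.

(** * Graph distance and the monomial order *)

Section Distance.

Variables (V : finType) (G : multigraph V).

Lemma dist_path u v :
  exists p, [/\ path (adj G) u p, last u p = v & size p = dist G u v].
Proof.
pose P d := [exists p : d.-tuple V, path (adj G) u p && (last u p == v)].
suff hP : has P (iota 0 #|V|).
  have := nth_find 0%N hP; rewrite nth_iota; last first.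
    by rewrite -[leqRHS](size_iota 0) -has_find.
  case/existsP=> p /andP[pth /eqP lst].
  by exists p; rewrite size_tuple.
have : connect (adj G) u v.
  suff /subsetP/(_ v) : [set: V] \subset [set w | connect (adj G) u w].
    by rewrite !inE; apply.
  apply: (connected_sub (connected_setT G) (in_setT u)).
    by rewrite inE connect0.
  move=> y z _; rewrite !inE => uy _ yz.
  exact: connect_trans uy (connect1 yz).
case/connectP=> p0 pth0 lst; case/shortenP: pth0 lst => p pth uniq_p _ lst.
apply/hasP; exists (size p).
  rewrite mem_iota add0n /=.
  by rewrite -[(size p).+1]/(size (u :: p)) -(card_uniqP uniq_p) max_card.
by apply/existsP; exists (in_tuple p); rewrite pth lst eqxx.
Qed.

Lemma dist_le u p : path (adj G) u p -> (dist G u (last u p) <= size p)%N.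
Proof.
move=> pth; rewrite leqNgt; apply/negP=> lt_p.
have := before_find 0%N lt_p; rewrite nth_iota => [|].
  rewrite add0n => /negbT/negP[]; apply/existsP.
  by exists (in_tuple p); rewrite pth eqxx.
by apply: leq_trans lt_p _; rewrite -[leqRHS](size_iota 0) find_size.
Qed.

Lemma dist_closer q v : v <> q ->
  exists2 w, adj G v w & (dist G w q < dist G v q)%N.
Proof.
move=> neq_vq; have [[|w p] [/= pth lst <-]] := dist_path v q; first by [].
case/andP: pth => vw pth; exists w => //.
by rewrite ltnS -lst; apply: dist_le.
Qed.

End Distance.

Section Degrevlex.

Variables (V : finType) (G : multigraph V) (q : V) (lev : rel V).
Hypothesis Hlev : variable_order G q lev.

Implicit Types m : monom V.

Lemma expoD m1 m2 v : expo (m1 + m2)%MM v = (expo m1 v + expo m2 v)%N.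
Proof. exact: mnmDE. Qed.

Lemma expo_inj m1 m2 : expo m1 =1 expo m2 -> m1 = m2.
Proof.
by move=> eqm; apply/mnmP=> i; have := eqm (enum_val i); rewrite /expo enum_valK.
Qed.

Lemma mdeg_expo m : mdeg m = (\sum_v expo m v)%N.
Proof.
rewrite mdegE (reindex (@enum_rank V)) //=.
by apply: onW_bij; apply: enum_rank_bij.
Qed.

Lemma degrevlex_ltP m1 m2 :
  reflect ((mdeg m1 < mdeg m2)%N \/ mdeg m1 = mdeg m2 /\
    exists2 v, (expo m2 v < expo m1 v)%N &
      forall w, lev w v -> w <> v -> expo m1 w = expo m2 w)
    (degrevlex_lt lev m1 m2).
Proof.
apply: (iffP orP) => -[]; try by left.
  case/andP=> /eqP eqd /existsP[v /andP[ltv /forallP eqw]]; right; split=> //.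
  by exists v => // w lewv /eqP neq_wv; apply/eqP/(implyP (eqw w))/andP.
case=> eqd [v ltv eqw]; right; rewrite eqd eqxx; apply/existsP; exists v.
rewrite ltv; apply/forallP=> w; apply/implyP=> /andP[lewv /eqP neq_wv].
by rewrite eqw.
Qed.

Lemma degrevlex_lt_irr m : ~~ degrevlex_lt lev m m.
Proof.
by apply/negP=> /degrevlex_ltP[|[_ [v]]]; rewrite ltnn.
Qed.

Lemma degrevlex_lt_trans : ssrbool.transitive (degrevlex_lt lev).
Proof.
case: Hlev => ltot lanti ltrans _ m2 m1 m3.
move=> /degrevlex_ltP[lt12 | [eq12 [v ltv eqv]]].
  move=> /degrevlex_ltP[lt23 | [eq23 _]]; apply/degrevlex_ltP; left.
    exact: ltn_trans lt23.
  by rewrite -eq23.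
move=> /degrevlex_ltP[lt23 | [eq23 [w ltw eqw]]]; apply/degrevlex_ltP.
  by left; rewrite eq12.
right; rewrite eq12; split=> //.
have [eq_vw | neq_vw] := eqVneq v w.
  exists v => [|u leuv neq_uv]; first by apply: ltn_trans ltv; rewrite eq_vw.
  by rewrite eqv // eqw // -eq_vw.
have [levw | lewv] := orP (ltot v w).
  exists v => [|u leuv neq_uv]; first by rewrite -eqw //; apply/eqP.
  rewrite eqv // eqw //; first exact: ltrans levw.
  by move=> eq_uw; case/eqP: neq_vw; apply: lanti; rewrite levw -eq_uw.
exists w => [|u leuw neq_uw]; first by rewrite eqv //; apply/eqP; rewrite eq_sym.
rewrite eqv ?eqw //; first exact: ltrans lewv.
by move=> eq_uv; case/eqP: neq_vw; apply: lanti; rewrite lewv -eq_uv leuw.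
Qed.

Lemma degrevlex_lt_total m1 m2 :
  m1 != m2 -> degrevlex_lt lev m1 m2 || degrevlex_lt lev m2 m1.
Proof.
case: Hlev => ltot lanti ltrans _ neq12.
case: (ltngtP (mdeg m1) (mdeg m2)) => [lt12 | lt21 | eqd].
- by apply/orP; left; apply/degrevlex_ltP; left.
- by apply/orP; right; apply/degrevlex_ltP; left.
have [v0 neqv0] : exists v, expo m1 v != expo m2 v.
  apply: contrapT => noneq; case/eqP: neq12; apply: expo_inj => v.
  by apply: contrapT => /eqP neqv; apply: noneq; exists v.
(* A rank for the variables, used to choose the smallest one at which the monomials differ. *)
pose below v := #|[set w | lev w v]|.
pose neq v := expo m1 v != expo m2 v.
case: (@arg_minnP _ v0 neq below neqv0) => v neqv minv.
have eqw w : lev w v -> w <> v -> expo m1 w = expo m2 w.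
  move=> lewv neq_wv; apply: contrapT => /eqP/minv; rewrite leqNgt => /negP[].
  apply: proper_card; apply/properP; split.
    by apply/subsetP=> u; rewrite !inE => leuw; apply: ltrans lewv.
  exists v; rewrite inE; first by have := ltot v v; rewrite orbb.
  by apply/negP=> levw; apply: neq_wv; apply: lanti; rewrite lewv.
move: neqv; rewrite /neq neq_ltn => /orP[lt12 | lt21]; apply/orP.
  right; apply/degrevlex_ltP; right; split=> //; exists v => // w lewv neq_wv.
  by rewrite eqw.
by left; apply/degrevlex_ltP; right; split=> //; exists v.
Qed.

Lemma degrevlex_total : total (degrevlex lev).
Proof.
move=> m1 m2; rewrite /degrevlex eq_sym; case: eqVneq => //= neq12.
by apply: degrevlex_lt_total; rewrite eq_sym.
Qed.

Lemma degrevlex_anti : antisymmetric (degrevlex lev).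
Proof.
move=> m1 m2 /andP[/predU1P[// | lt12] /predU1P[// | lt21]].
by case/negP: (degrevlex_lt_irr m1); apply: degrevlex_lt_trans lt21.
Qed.

Lemma degrevlex_trans : ssrbool.transitive (degrevlex lev).
Proof.
move=> m2 m1 m3 /predU1P[-> // | lt12] /predU1P[<- | lt23].
  by rewrite /degrevlex lt12 orbT.
by rewrite /degrevlex (degrevlex_lt_trans lt12 lt23) orbT.
Qed.

Lemma degrevlex_add m m1 m2 :
  degrevlex lev m1 m2 -> degrevlex lev (m + m1)%MM (m + m2)%MM.
Proof.
move=> /predU1P[-> | lt12]; first by rewrite /degrevlex eqxx.
apply/orP; right; case/degrevlex_ltP: lt12 => [ltd | [eqd [v ltv eqw]]].
  by apply/degrevlex_ltP; left; rewrite !mdegD ltn_add2l.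
apply/degrevlex_ltP; right; rewrite !mdegD eqd; split=> //.
exists v => [|w lewv neq_wv]; first by rewrite !expoD ltn_add2l.
by rewrite !expoD eqw.
Qed.

(** A finite form of well-foundedness, due to the comparison of degrees; [schreyer_finite] passes it
    on to the module orders. *)
Lemma degrevlex_finite m :
  exists s : seq (monom V), forall m', degrevlex lev m' m -> m' \in s.
Proof.
exists [seq val b | b : 'X_{1..#|V| < (mdeg m).+1}] => m' lem'.
have ltm' : (mdeg m' < (mdeg m).+1)%N.
  rewrite ltnS; case/predU1P: lem' => [-> // |].
  by case/degrevlex_ltP=> [/ltnW | [-> _]].
by apply/imageP; exists (BMultinom ltm').
Qed.

End Degrevlex.

(** * Chip firing *)

Section ChipFiring.

Variables (V : finType) (G : multigraph V) (q : V).

Import Order.TTheory Num.Theory.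

Implicit Types m : monom V.

Lemma picP (D1 D2 : divisor V) :
  pic G D1 = pic G D2 <-> exists f, D1 - D2 = laplacian G f.
Proof.
rewrite /pic; split=> [/eqP | D12].
  by rewrite -Quotient.idealrBE => /asboolP.
by apply/eqP; rewrite -Quotient.idealrBE; apply/asboolP.
Qed.

Lemma sum_laplacian f : \sum_v laplacian G f v = 0.
Proof.
pose e v w : int := (mult G v w)%:Z * f v.
have -> : \sum_v laplacian G f v = \sum_v \sum_w e v w - \sum_v \sum_w e w v.
  rewrite -sumrB; apply: eq_bigr => v _; rewrite ffunE -sumrB.
  by apply: eq_bigr => w _; rewrite /e (mult_sym G w v) mulrBr.
by rewrite [X in _ - X]exchange_big /= subrr.
Qed.

Lemma pic_mdeg m1 m2 : pic G (div_of_mon m1) = pic G (div_of_mon m2) ->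
  mdeg m1 = mdeg m2.
Proof.
case/picP=> f eqf; apply/eqP; rewrite -eqz_nat -subr_eq0 !mdeg_expo.
rewrite !(big_morph Posz PoszD (erefl _)) -sumrB.
apply/eqP; rewrite -[RHS](sum_laplacian f) -eqf.
by apply: eq_bigr => v _; rewrite !ffunE.
Qed.

Lemma laplacian_cut (A : {set V}) v :
  laplacian G (fun w => (w \in A)%:Z) v =
    (cut_exp G A (~: A) v)%:Z - (cut_exp G (~: A) A v)%:Z.
Proof.
rewrite ffunE /cut_exp /edges_to in_setC; case: (v \in A) => /=.
  rewrite subr0 [in RHS]big_mkcond (big_morph Posz PoszD (erefl _)) /=.
  apply: eq_bigr => w _; rewrite in_setC.
  by case: (w \in A); rewrite ?subrr ?subr0 ?mulr0 ?mulr1.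
rewrite sub0r [in RHS]big_mkcond (big_morph Posz PoszD (erefl _)) /= -sumrN.
apply: eq_bigr => w _.
by case: (w \in A); rewrite ?subrr ?sub0r ?mulr0 ?mulrN1 ?oppr0.
Qed.

(** At a maximum of [f] no term of the Laplacian is negative, and since [f] is integral each edge to
    a smaller value contributes at least 1. *)
Lemma cut_lower (f : V -> int) (A : {set V}) v :
  (forall w, f w <= f v) -> (forall w, w \in A -> adj G v w -> f w < f v) ->
  (edges_to G v A)%:Z <= laplacian G f v.
Proof.
move=> maxv ltv; rewrite ffunE /edges_to big_mkcond.
rewrite (big_morph Posz PoszD (erefl _)) /=; apply: ler_sum => w _.
have pos : 0 <= (mult G v w)%:Z * (f v - f w) by rewrite mulr_ge0 ?subr_ge0.
case: ifP => // wA; case: (posnP (mult G v w)) => [eq0 | vw].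
  by rewrite eq0 in pos *.
rewrite -[leLHS]mulr1 ler_wpM2l // -[1]add0r lezD1 subr_gt0.
exact: ltv.
Qed.

(* Dhar's burning argument: the set where [f] is maximal can be fired from
   [m1]; cut off the component of [q] in the complement of one of its
   components. *)
Lemma fire_cut (f : V -> int) m1 m2 :
  div_of_mon m1 - div_of_mon m2 = laplacian G f -> ~ (forall v, f v <= f q) ->
  exists U : {set V}, [/\ q \in U, flag_step G U setT
    & forall v, (cut_exp G (setT :\: U) U v <= expo m1 v)%N].
Proof.
move=> eqf nmax; case: (@arg_maxP _ _ _ q xpredT f isT) => t _ maxf.
have maxt v : f v <= f t by apply: maxf.
have lt_qt : f q < f t.
  rewrite ltNge; apply/negP=> le_tq; apply: nmax => v.
  exact: le_trans (maxt v) le_tq.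
have tA : t \in [set v | f v == f t] by rewrite inE.
have [A [tA' sA cA clA]] := component (adj_sym G) tA.
have fA v : v \in A -> f v = f t by move/(subsetP sA); rewrite inE => /eqP.
have qA : q \in setT :\: A.
  rewrite in_setD in_setT andbT; apply/negP=> /fA eq_qt.
  by rewrite eq_qt ltxx in lt_qt.
have [U [qU sU cU cU' clU]] :=
  split_off (adj_sym G) (connected_setT G) cA (subsetT A) qA.
exists U; split=> //.
  apply/and3P; split=> //; apply/properP; split; first exact: subsetT.
  exists t => //; apply/negP=> /(subsetP sU); rewrite in_setD tA' //.
move=> v; rewrite /cut_exp; case: ifP => // /setDP[_ vU].
have [vA | vA] := boolP (v \in A); last first.
  rewrite edges_to_eq0 // => w wU; apply: contra vU => vw.
  apply: (clU w) => //; first by rewrite in_setD vA in_setT.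
  by rewrite adj_sym.
(* A neighbour of [v] in [U] has a smaller value, since with an equal one it would belong to the
   component [A]. The bound by [m1] follows because the Laplacian is [m1 - m2] and [m2] has no
   negative exponent. *)
have lev : (edges_to G v U)%:Z <= laplacian G f v.
  apply: cut_lower => [w | w wU vw]; first by rewrite (fA v) //; apply: maxt.
  rewrite (fA v) // lt_neqAle maxt // andbT; apply/negP=> eq_wt.
  have /(subsetP sU) := wU; rewrite in_setD (clA v w) //.
  by rewrite inE.
have := le_trans lev (_ : _ <= (expo m1 v)%:Z); rewrite lez_nat; apply.
by rewrite -eqf !ffunE lerBlDr lerDl.
Qed.

Section LeadingTerm.

Variable lev : rel V.
Hypothesis Hlev : variable_order G q lev.

(* A vertex other than [q] has a neighbour closer to [q], hence smaller: by
   induction on the distance, [f] is maximal at the smallest vertex where [m1]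
   and [m2] differ. *)
Lemma fire_from_q (f : V -> int) m1 m2 :
  div_of_mon m1 - div_of_mon m2 = laplacian G f -> (forall v, f v <= f q) ->
  ~~ degrevlex_lt lev m2 m1.
Proof.
case: Hlev => ltot lanti ltrans ldist eqf maxq.
have eqd : mdeg m1 = mdeg m2 by apply: pic_mdeg; apply/picP; exists f.
have eqfv v : laplacian G f v = (expo m1 v)%:Z - (expo m2 v)%:Z.
  by rewrite -eqf !ffunE.
apply/negP=> /degrevlex_ltP[|[_ [v0 ltv eqw]]]; first by rewrite eqd ltnn.
have eqfq n v : (dist G v q < n)%N -> lev v v0 -> f v = f q.
  elim: n v => // n IHn v; rewrite ltnS => ledn lev_v.
  have [-> // | /eqP neq_vq] := eqVneq v q.
  have [w vw lt_wv] := dist_closer G neq_vq.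
  have /andP[lev_wv /eqP neq_wv] := ldist v w lt_wv.
  have lev_w : lev w v0 := ltrans _ _ _ lev_wv lev_v.
  have fw : f w = f q by apply: IHn => //; apply: leq_trans ledn.
  (* The exponents at [w] agree because [w] is smaller than [v0]. A vanishing Laplacian at a maximum
     of [f] forces the same value on all neighbours, [v] among them. *)
  have : laplacian G f w = 0.
    rewrite eqfv eqw ?subrr // => eq_w.
    by apply: neq_wv; apply: lanti; rewrite lev_wv eq_w.
  move/eqP; rewrite ffunE psumr_eq0 => [|u _]; last first.
    by rewrite mulr_ge0 // subr_ge0 fw.
  move/allP/(_ v (mem_index_enum v)); rewrite mulf_eq0 eqz_nat subr_eq0 fw.
  by rewrite (gtn_eqF (_ : 0 < mult G w v)%N) 1?mult_sym //= => /eqP.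
have fv0 : f v0 = f q.
  by apply: (eqfq (dist G v0 q).+1) => //; have := ltot v0 v0; rewrite orbb.
have : 0 <= laplacian G f v0.
  by rewrite ffunE; apply: sumr_ge0 => u _; rewrite mulr_ge0 // subr_ge0 fv0.
by rewrite eqfv subr_ge0 lez_nat leqNgt ltv.
Qed.

End LeadingTerm.

End ChipFiring.

(** * Free modules *)

(* These operations are locked: failing unification attempts between unfolded
   finite functions over polynomials are very slow. *)
HB.lock Definition single (K : fieldType) (V T : finType) (t : T)
  (p : polyring K V) : freemod K V T := [ffun s => if s == t then p else 0].
Arguments single {K} V {T} t p.

Lemma singleE (K : fieldType) (V T : finType) t (p : polyring K V) (s : T) :
  single V t p s = if s == t then p else 0.
Proof. by rewrite single.unlock ffunE. Qed.

HB.lock Definition fscale (K : fieldType) (V T : finType)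
  (p : polyring K V) (f : freemod K V T) : freemod K V T := p *: f.

HB.lock Definition comb (K : fieldType) (V T T' : finType)
    (g : T' -> freemod K V T) (u : freemod K V T') : freemod K V T :=
  \sum_t (u t : polyring K V) *: g t.

Section Terms.

Variables (K : fieldType) (V T : finType).

Implicit Types (f h : freemod K V T) (p : polyring K V) (a b : mterm V T) (t : T).

Definition tmul (T' : finType) (m : monom V) (a : mterm V T') : mterm V T' :=
  ((m + a.1)%MM, a.2).

Lemma tmul_inj m : injective (@tmul T m).
Proof.
move=> [m1 t1] [m2 t2] eq12.
have eq1 : m1 = m2 by apply: (@addmI _ m); apply: (congr1 fst eq12).
by rewrite eq1 (congr1 snd eq12 : t1 = t2).
Qed.

Lemma tmulD m1 m2 a : tmul (m1 + m2)%MM a = tmul m1 (tmul m2 a).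
Proof. by rewrite /tmul addmA. Qed.

Definition tcoef f a : K := (f a.2 : polyring K V)@_a.1.

Lemma in_supportE f a : in_support f a = (tcoef f a != 0).
Proof. exact: mcoeff_msupp. Qed.

Lemma tcoef_sub f h a : tcoef (f - h) a = tcoef f a - tcoef h a.
Proof. by rewrite /tcoef !ffunE; apply: mcoeffB. Qed.

Lemma tcoefD f h a : tcoef (f + h) a = tcoef f a + tcoef h a.
Proof. by rewrite /tcoef ffunE; apply: mcoeffD. Qed.

Lemma tcoef_sum (I : finType) (F : I -> freemod K V T) a :
  tcoef (\sum_i F i) a = \sum_i tcoef (F i) a.
Proof.
apply: (big_morph (fun f => tcoef f a)) => [f h|]; first exact: tcoefD.
by rewrite /tcoef ffunE mcoeff0.
Qed.

Lemma in_supportD f h a :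
  in_support (f + h) a -> in_support f a \/ in_support h a.
Proof.
rewrite !in_supportE tcoefD => nz; apply/orP; apply: contraR nz.
by rewrite negb_or !negbK => /andP[/eqP-> /eqP->]; rewrite addr0.
Qed.

Lemma in_supportB f h a :
  in_support (f - h) a -> in_support f a \/ in_support h a.
Proof.
rewrite !in_supportE tcoef_sub => nz; apply/orP; apply: contraR nz.
by rewrite negb_or !negbK => /andP[/eqP-> /eqP->]; rewrite subr0.
Qed.

Lemma in_support_fscale p f b : in_support (fscale p f) b ->
  exists m a, [/\ m \in msupp p, in_support f a & b = tmul m a].
Proof.
rewrite fscale.unlock; case: b => n t; rewrite /in_support /= ffunE => /msuppM_le.
case/allpairsP=> -[m1 m2] /= [m1p m2f ->].
by exists m1, (m2, t).
Qed.

Lemma tcoef_fscale p f m a :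
  (forall m' a', m' \in msupp p -> in_support f a' ->
    tmul m' a' = tmul m a -> m' = m) ->
  tcoef (fscale p f) (tmul m a) = p@_m * tcoef f a.
Proof.
rewrite fscale.unlock; case: a => n t uniq; rewrite /tcoef /= ffunE mcoeffM.
have ltm : (mdeg m < (mdeg (m + n)).+1)%N by rewrite mdegD ltnS leq_addr.
have ltn : (mdeg n < (mdeg (m + n)).+1)%N by rewrite mdegD ltnS leq_addl.
rewrite (bigD1 (BMultinom ltm, BMultinom ltn)) //= big1 ?addr0 //.
move=> [[k1 H1] [k2 H2]] /=.
case/andP=> /eqP eqmn /eqP neq; apply/eqP; rewrite mulf_eq0.
apply/norP => -[]; rewrite -!mcoeff_msupp => k1p k2f; apply: neq.
have eq1 : k1 = m by apply: (uniq k1 (k2, t)) => //; rewrite /tmul /= -eqmn.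
have eq2 : k2 = n by apply: (@addmI _ m); rewrite eqmn eq1.
by congr (_, _); apply: val_inj.
Qed.

Lemma in_support_neq0 f : f <> 0 -> exists a, in_support f a.
Proof.
move=> nz; apply: contrapT => none; apply: nz; apply/ffunP=> t; rewrite ffunE.
apply/mpolyP=> m; rewrite mcoeff0; apply/eqP; rewrite -[_ == _]negbK.
by apply/negP; rewrite -mcoeff_msupp => mt; apply: none; exists (m, t).
Qed.

Lemma tcoef_single t p a :
  tcoef (single V t p) a = if a.2 == t then p@_a.1 else 0.
Proof. by rewrite /tcoef singleE; case: eqP => // _; apply: mcoeff0. Qed.

Lemma in_support_single t (c : K) m a :
  in_support (single V t (c *: 'X_[m])) a -> a = (m, t).
Proof.
rewrite in_supportE tcoef_single.
case: (a.2 =P t) => [<-|]; last by rewrite eqxx.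
rewrite mcoeffZ mcoeffX; case: (m =P a.1) => [->|]; last by rewrite mulr0 eqxx.
by case: a.
Qed.

Lemma in_support0 a : ~~ in_support (0 : freemod K V T) a.
Proof. by rewrite /in_support ffunE msupp0. Qed.

Section Combinations.

Variables (T' : finType) (g : T' -> freemod K V T).

Implicit Types u v : freemod K V T'.

Lemma comb0 : comb g 0 = 0.
Proof. by rewrite comb.unlock big1 // => t _; rewrite ffunE scale0r. Qed.

Lemma combD u v : comb g (u + v) = comb g u + comb g v.
Proof.
rewrite comb.unlock -big_split /=; apply: eq_bigr => t _.
by rewrite ffunE -scalerDl.
Qed.

Lemma combB u v : comb g (u - v) = comb g u - comb g v.
Proof.
rewrite comb.unlock -sumrB; apply: eq_bigr => t _.
by rewrite !ffunE -scalerBl.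
Qed.

Lemma combZ p u : comb g (p *: u) = p *: comb g u.
Proof.
rewrite comb.unlock scaler_sumr; apply: eq_bigr => t _.
by rewrite ffunE scalerA.
Qed.

Lemma comb_single (t : T') p : comb g (single V t p) = fscale p (g t).
Proof.
rewrite comb.unlock fscale.unlock (bigD1 t) //=.
rewrite big1 ?addr0 => [|s /negPf neq].
  by rewrite singleE eqxx.
by rewrite singleE neq scale0r.
Qed.

Lemma tcoef_comb u a : tcoef (comb g u) a = \sum_t tcoef (fscale (u t) (g t)) a.
Proof.
rewrite comb.unlock tcoef_sum; apply: eq_bigr => t _.
by rewrite fscale.unlock.
Qed.

End Combinations.

Section Order.

Variables (lev : rel V) (ord : rel (mterm V T)).
Hypothesis Hord : module_order lev ord.

Lemma ord_refl a : ord a a.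
Proof. by case: Hord => tot _ _ _ _; have := tot a a; rewrite orbb. Qed.

Lemma ord_anti a b : ord a b -> ord b a -> a = b.
Proof. by case: Hord => _ anti _ _ _ ab ba; apply: anti; rewrite ab. Qed.

Lemma ord_trans a b c : ord a b -> ord b c -> ord a c.
Proof. by case: Hord => _ _ tr _ _; apply: tr. Qed.

Lemma ord_tmul m a b : ord a b -> ord (tmul m a) (tmul m b).
Proof. by case: Hord => _ _ _ _; case: a b => [m1 t1] [m2 t2]; apply. Qed.

Lemma is_LM_exists f : f <> 0 -> exists a, is_LM ord f a.
Proof.
move/in_support_neq0=> [a0 sa0].
pose s := [seq (m, t) | t <- enum T, m <- msupp (f t : polyring K V)].
have mem_s b : in_support f b -> b \in s.
  case: b => m t mt; apply/allpairsPdep; exists t, m; split=> //.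
  by rewrite mem_enum.
suff [a sa maxa] : exists2 a, in_support f a &
    forall b, b \in s -> in_support f b -> ord b a.
  by exists a; split=> // b sb; apply: maxa => //; apply: mem_s.
elim: s {mem_s} => [|b s [a sa maxa]]; first by exists a0.
have [sb | nsb] := boolP (in_support f b); last first.
  exists a => // c; rewrite inE => /predU1P[-> | /maxa //].
  by rewrite (negPf nsb).
have [tot _ _ _ _] := Hord.
have [leab | leba] := orP (tot a b).
  exists b => // c; rewrite inE => /predU1P[-> _ | cs sc]; first exact: ord_refl.
  exact: ord_trans (maxa c cs sc) leab.
by exists a => // c; rewrite inE => /predU1P[-> // | /maxa].
Qed.

Definition finite_below := forall a, exists s : seq (mterm V T),
  forall b, ord b a -> b \in s.

Lemma ord_ind (P : mterm V T -> Prop) : finite_below ->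
  (forall a, (forall b, ord b a -> b <> a -> P b) -> P a) -> forall a, P a.
Proof.
move=> fin IH a; have [s] := fin a; elim: {s}_.+1 {-2}s (ltnSn (size s)) a => //.
move=> n IHn s lesn a sa; apply: IH => b leba neq_ba.
have a_s : a \in s by apply: sa; apply: ord_refl.
(* [a] itself is not below [b], so the shorter list still contains everything below [b]. *)
apply: (IHn (rem a s)).
  by rewrite size_rem //; case: (s) lesn a_s.
move=> c lecb; have cs : c \in s by apply: sa; apply: ord_trans lecb leba.
apply: contraT => /negP ncs; case: neq_ba; apply: ord_anti => //.
suff <- : c = a by [].
apply: contrapT => /eqP neq_ca; apply: ncs.
by move: cs; rewrite (perm_mem (perm_to_rem a_s)) inE (negPf neq_ca).
Qed.

End Order.

End Terms.

Section Submodules.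

Variables (R : comNzRingType) (M : lmodType R).

Definition is_submod (P : M -> Prop) : Prop :=
  P 0 /\ forall (r : R) x y, P x -> P y -> P (r *: x + y).

Lemma lin_span_submod (P : M -> Prop) : is_submod (lin_span P).
Proof.
split=> [|r x y [s Ps ->] [s' Ps' ->]]; first by exists [::]; rewrite ?big_nil.
exists ([seq (r * p.1, p.2) | p <- s] ++ s') => [p|].
  by rewrite mem_cat => /orP[/mapP[p' /Ps Pp' ->] | /Ps'].
rewrite big_cat big_map scaler_sumr; congr (_ + _); apply: eq_bigr => p _.
by rewrite scalerA.
Qed.

Lemma lin_span_sub (P Q : M -> Prop) : is_submod Q -> (forall x, P x -> Q x) ->
  forall x, lin_span P x -> Q x.
Proof.
case=> Q0 QL PQ x [s Ps ->]; elim: s Ps => [|p s IHs] Ps.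
  by rewrite big_nil.
rewrite big_cons; apply: QL; first by apply/PQ/Ps/mem_head.
by apply: IHs => p' p's; apply: Ps; rewrite inE p's orbT.
Qed.

Lemma lin_span_mem (P : M -> Prop) r x : P x -> lin_span P (r *: x).
Proof.
by move=> Px; exists [:: (r, x)] => [p|]; rewrite ?inE ?big_seq1 // => /eqP->.
Qed.

End Submodules.

(** * Schreyer's algorithm *)

Section TermDegree.

Variables (V T : finType) (Z : zmodType) (dg : monom V -> Z) (d : T -> Z).

Definition tdeg (a : mterm V T) : Z := dg a.1 + d a.2.

Lemma tdeg_tmul m (a : mterm V T) :
  (forall m1 m2, dg (m1 + m2)%MM = dg m1 + dg m2) ->
  tdeg (tmul m a) = dg m + tdeg a.
Proof. by move=> dgD; rewrite /tdeg /= dgD addrA. Qed.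

End TermDegree.

(** The invariant of the induction. The leading monomials [x] are a parameter because the flags
    prescribe them before the elements [g] exist. *)
Record standard_basis (K : fieldType) (V T T' : finType) (Z : zmodType)
    (dg : monom V -> Z) (d : T -> Z) (ord : rel (mterm V T))
    (M : freemod K V T -> Prop) (g : T' -> freemod K V T)
    (x : T' -> mterm V T) : Prop := StandardBasis {
  sb_mem : forall t, M (g t);
  sb_LM : forall t, is_LM ord (g t) (x t);
  sb_monic : forall t, tcoef (g t) (x t) = 1;
  sb_homog : forall t a, in_support (g t) a -> tdeg dg d a = tdeg dg d (x t);
  sb_groebner : forall f a, M f -> is_LM ord f a ->
    exists t m, a = tmul m (x t)
}.

Section Schreyer.

Variables (K : fieldType) (V T T' : finType) (lev : rel V).
Variables (Z : zmodType) (dg : monom V -> Z) (d : T -> Z).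
Hypothesis dgD : forall m1 m2, dg (m1 + m2)%MM = dg m1 + dg m2.

Local Notation tdeg := (tdeg dg).

Variable ord : rel (mterm V T).
Hypotheses (Hord : module_order lev ord) (fin_ord : finite_below ord).

Variables (M : freemod K V T -> Prop) (g : T' -> freemod K V T).
Variable x : T' -> mterm V T.
Hypotheses (subM : is_submod M) (sbg : standard_basis dg d ord M g x).

(* The leading monomial of [x^m g_t], as a function of the monomial [x^m [t]]. *)
Definition lift_term (a : mterm V T') : mterm V T := tmul a.1 (x a.2).

(** A multiple of some [g t] cancels the leading term, and induction on [a] treats the rest. The
    bound and the degree recorded for [u] later control the leading monomial and the homogeneity of
    the syzygies. *)
Lemma standard_division a c f : M f ->
  (forall b, in_support f b -> ord b a /\ tdeg d b = c) ->
  exists u : freemod K V T', f = comb g u /\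
    forall e, in_support u e -> ord (lift_term e) a /\ tdeg d (lift_term e) = c.
Proof.
move: a f; apply: (ord_ind Hord fin_ord) => a IH f Mf supf.
have [-> | /eqP nz_f] := eqVneq f 0.
  by exists 0; rewrite comb0; split=> // e; rewrite (negPf (in_support0 K e)).
have [b LMb] := is_LM_exists Hord nz_f; have [sb maxb] := LMb.
have [t [m def_b]] := sb_groebner sbg Mf LMb.
have [leba degb] := supf b sb.
pose p : polyring K V := tcoef f b *: 'X_[m].
have sup1 e : in_support (single V t p) e ->
    ord (lift_term e) a /\ tdeg d (lift_term e) = c.
  by move/in_support_single=> ->; rewrite /lift_term /= -def_b.
pose h := fscale p (g t).
have sup_h e : in_support h e ->
    exists2 a', in_support (g t) a' & e = tmul m a'.
  case/in_support_fscale=> [m' [a' [m'p sa' ->]]].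
  by move/msuppZ_le: m'p; rewrite msuppX inE => /eqP->; exists a'.
have coef_h : tcoef h b = tcoef f b.
  rewrite {1}def_b tcoef_fscale => [|m' a' m'p _ _].
    by rewrite mcoeffZ mcoeffX eqxx (sb_monic sbg) !mulr1.
  by move/msuppZ_le: m'p; rewrite msuppX inE => /eqP.
pose f' := f - h.
have Mf' : M f'.
  rewrite /f' addrC /h fscale.unlock -scaleNr.
  by case: subM => _; apply=> //; apply: sb_mem sbg t.
have supf' e : in_support f' e -> [/\ ord e b, e <> b & tdeg d e = c].
  move=> se; split.
  - case/in_supportB: (se) => [/maxb // | /sup_h[a' sa' ->]].
    by rewrite def_b; apply: (ord_tmul Hord); apply: (sb_LM sbg t).2.
  - move=> eb; move: se.
    by rewrite in_supportE tcoef_sub eb coef_h subrr eqxx.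
  - case/in_supportB: (se) => [/supf[] // | /sup_h[a' sa' ->]].
    by rewrite tdeg_tmul // (sb_homog sbg sa') -tdeg_tmul // -def_b.
have def_f : f = h + f' by rewrite addrC subrK.
have [f'0 | /eqP nz_f'] := eqVneq f' 0.
  by exists (single V t p); rewrite comb_single def_f f'0 addr0.
have [b' [sb' maxb']] := is_LM_exists Hord nz_f'.
have [leb'b neq_b'b _] := supf' b' sb'.
have [|||u [def_f' supu]] := IH b' _ _ f' Mf'.
- exact: (ord_trans Hord leb'b leba).
- move=> eq_b'a; rewrite eq_b'a in leb'b neq_b'b; apply: neq_b'b.
  exact: (ord_anti Hord leb'b leba).
- by move=> e se; split; [apply: maxb' | case: (supf' e se)].
exists (single V t p + u); split; first by rewrite combD comb_single -def_f'.
move=> e /in_supportD[/sup1 // | /supu[lee ->]]; split=> //.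
exact: (ord_trans Hord lee (ord_trans Hord leb'b leba)).
Qed.

Variable tie : rel T'.

Definition same_component s t : Prop := (x s).2 = (x t).2.

(** [tie] only decides between monomials with equal lifts, whose symbols share a component. For
    flags, antisymmetry could fail between equal heads with different tails. *)
Definition tie_order : Prop :=
  [/\ forall s t, same_component s t -> tie s t || tie t s,
      forall s t, same_component s t -> tie s t -> tie t s -> s = t
    & forall r s t, same_component r s -> same_component s t ->
        tie r s -> tie s t -> tie r t].

Hypothesis Htie : tie_order.

Definition schreyer_order : rel (mterm V T') := fun a b =>
  if lift_term a == lift_term b then tie a.2 b.2
  else ord (lift_term a) (lift_term b).

Lemma lift_tmul m a : lift_term (tmul m a) = tmul m (lift_term a).
Proof. exact: tmulD. Qed.

Lemma lift_inj t m1 m2 : lift_term (m1, t) = lift_term (m2, t) -> m1 = m2.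
Proof.
move/(congr1 fst) => /= eq12; apply: (@addmI _ (x t).1).
by rewrite ![((x t).1 + _)%MM]addmC.
Qed.

Lemma lift_component a b :
  lift_term a = lift_term b -> same_component a.2 b.2.
Proof. by move/(congr1 snd). Qed.

Lemma schreyer_lift a b :
  schreyer_order a b -> ord (lift_term a) (lift_term b).
Proof.
by rewrite /schreyer_order; case: eqP => // -> _; apply: (ord_refl Hord _).
Qed.

Lemma schreyer_module_order : module_order lev schreyer_order.
Proof.
case: Htie => tie_tot tie_anti tie_trans.
have [tot _ _ ext _] := Hord.
split.
- move=> a b; rewrite /schreyer_order [lift_term b == _]eq_sym.
  by case: eqP => [/lift_component/tie_tot | _].
- move=> a b /andP[]; rewrite /schreyer_order [lift_term b == _]eq_sym.
  case: eqP => [eq_ab | neq_ab leab leba]; last first.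
    by case: neq_ab; apply: (ord_anti Hord leab leba).
  move=> tab tba; have := tie_anti _ _ (lift_component eq_ab) tab tba.
  case: a b eq_ab {tab tba} => [m1 t1] [m2 t2] /= eq_ab eq_t.
  by rewrite eq_t in eq_ab *; rewrite (lift_inj eq_ab).
- move=> b a c sab sbc; have := schreyer_lift sab; have := schreyer_lift sbc.
  move: sab sbc; rewrite /schreyer_order.
  case: (lift_term a =P lift_term b) => [eq_ab | neq_ab].
    rewrite eq_ab; case: eqP => // /lift_component eq_bc.
    move=> tab tbc _ _; apply: tie_trans tab tbc => //.
    exact: lift_component.
  move=> _ sbc lebc leab; case: eqP => [eq_ac|_]; last first.
    exact: (ord_trans Hord leab lebc).
  by case: neq_ab; apply: (ord_anti Hord leab _); rewrite eq_ac.
- move=> m1 m2 t le12; rewrite /schreyer_order; case: eqP => _ /=.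
    by have := tie_tot t t erefl; rewrite orbb.
  rewrite /lift_term /tmul /= ![(_ + (x t).1)%MM]addmC.
  exact: (ord_tmul Hord _ (ext _ _ (x t).2 le12)).
- move=> m m1 m2 t1 t2; rewrite /schreyer_order.
  rewrite -!/(tmul m (_, _)) !lift_tmul (inj_eq (@tmul_inj _ _ _)).
  by case: ifP => // _; apply: (ord_tmul Hord).
Qed.

Lemma schreyer_finite : finite_below schreyer_order.
Proof.
move=> a; have [s sP] := fin_ord (lift_term a).
exists [seq ((c.1 - (x t).1)%MM, t) | c <- s, t <- enum T'] => -[m t].
move/schreyer_lift/sP => b_s; apply/allpairsP.
exists (lift_term (m, t), t) => /=; rewrite mem_enum; split=> //.
by rewrite addmK.
Qed.

Section Syzygies.

Variables (T2 : finType) (x2 : T2 -> mterm V T').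

Hypothesis colon_gen : forall r, exists s,
  [/\ same_component s (x2 r).2, tie s (x2 r).2, s <> (x2 r).2
    & (x2 r).1 = ((x s).1 - (x (x2 r).2).1)%MM].

Hypothesis colon_div : forall s t, same_component s t -> tie s t -> s <> t ->
  exists r, (x2 r).2 = t /\ ((x2 r).1 <= (x s).1 - (x t).1)%MM.

Definition syzygies (u : freemod K V T') : Prop := comb g u = 0.

Definition lift_deg (t : T') : Z := tdeg d (x t).

Lemma tdeg_lift a : tdeg lift_deg a = tdeg d (lift_term a).
Proof. by rewrite /tdeg /lift_deg /tdeg /= dgD addrA. Qed.

(** The leading monomials of the S-pair of [g t] and [g s] cancel; subtracting the result [u] of its
    division turns the pair into a syzygy. *)
Lemma s_pair r : exists h, [/\ syzygies h, is_LM schreyer_order h (x2 r),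
  tcoef h (x2 r) = 1
  & forall a, in_support h a -> tdeg lift_deg a = tdeg lift_deg (x2 r)].
Proof.
have [s [comp_st tie_st neq_st def_m]] := colon_gen r.
case: (x2 r) comp_st tie_st neq_st def_m => m t /= comp_st tie_st neq_st def_m.
(* The cofactor of [g s]: by the truncated subtraction in [def_m], [m + (x t).1] is the least common
   multiple of the two leading exponents. *)
pose p := (m + (x t).1 - (x s).1)%MM.
have le_xs : ((x s).1 <= m + (x t).1)%MM.
  by apply/mnm_lepP=> i; rewrite def_m !mnmE addnC -leq_subLR.
pose Y := lift_term (m, t).
have Ys : Y = lift_term (p, s) by rewrite /Y /lift_term /tmul /= submK ?comp_st.
pose S := fscale 'X_[m] (g t) - fscale 'X_[p] (g s).
have MS : M S.
  case: subM => M0 ML; rewrite /S fscale.unlock addrC -scaleNr.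
  apply: (ML); first exact: sb_mem sbg s.
  by rewrite -['X_[m] *: g t]addr0; apply: (ML) => //; apply: sb_mem sbg t.
have mon_sup n t' e : in_support (fscale 'X_[n] (g t')) e ->
    ord e (lift_term (n, t')) /\ tdeg d e = tdeg d (lift_term (n, t')).
  case/in_support_fscale=> m' [a' [m'p sa' ->]].
  move: m'p; rewrite msuppX inE => /eqP->; split.
    by apply: (ord_tmul Hord); apply: (sb_LM sbg t').2.
  by rewrite !tdeg_tmul // (sb_homog sbg sa').
have mon_coef n t' : tcoef (fscale 'X_[n] (g t')) (lift_term (n, t')) = 1.
  rewrite tcoef_fscale => [|m' a' m'p _ _]; last first.
    by move: m'p; rewrite msuppX inE => /eqP.
  by rewrite mcoeffX eqxx (sb_monic sbg) mulr1.
have supS e : in_support S e -> [/\ ord e Y, e <> Y & tdeg d e = tdeg d Y].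
  move=> se; have [leY degY] : ord e Y /\ tdeg d e = tdeg d Y.
    by case/in_supportB: (se) => /mon_sup; rewrite -?Ys.
  split; [exact: leY | | exact: degY] => eY; move: se.
  by rewrite in_supportE eY tcoef_sub {2}Ys !mon_coef subrr eqxx.
have [u [def_S supu]] : exists u : freemod K V T', S = comb g u /\
    forall e, in_support u e -> [/\ ord (lift_term e) Y, lift_term e <> Y
      & tdeg d (lift_term e) = tdeg d Y].
  have [S0 | /eqP nzS] := eqVneq S 0.
    by exists 0; rewrite comb0; split=> // e; rewrite (negPf (in_support0 K e)).
  have [b [sb maxb]] := is_LM_exists Hord nzS.
  have [lebY neq_bY _] := supS b sb.
  (* The bound is the leading monomial [b] of [S] and not [Y], so the terms of [u] lift strictly
     below [Y]. *)
  have [|u [def_S supu]] := @standard_division b (tdeg d Y) S MS.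
    by move=> e se; split; [apply: maxb | case: (supS e se)].
  exists u; split=> // e /supu[leb ->]; split=> //.
    exact: (ord_trans Hord leb lebY).
  by move=> eY; apply: neq_bY; apply: (ord_anti Hord lebY _); rewrite -eY.
pose h := single V t 'X_[m] - single V s 'X_[p] - u.
have suph e : in_support h e -> [\/ e = (m, t), e = (p, s) | in_support u e].
  case/in_supportB=> [/in_supportB[]|]; last by constructor 3.
    by rewrite -['X_[m]]scale1r => /in_support_single; constructor 1.
  by rewrite -['X_[p]]scale1r => /in_support_single; constructor 2.
have coefh : tcoef h (m, t) = 1.
  rewrite !tcoef_sub !tcoef_single /= eqxx mcoeffX eqxx.
  rewrite [t == s]eq_sym (negPf (introN eqP neq_st)) subr0.
  have [->|nz] := eqVneq (tcoef u (m, t)) 0; first by rewrite subr0.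
  by have := supu (m, t); rewrite in_supportE nz => /(_ isT)[_ /(_ erefl)].
exists h; split; [ | | exact: coefh | ].
- by rewrite /syzygies !combB !comb_single -def_S subrr.
- split; first by rewrite in_supportE coefh oner_eq0.
  move=> e /suph[-> | -> | /supu[leY neqY _]].
  + exact: (ord_refl schreyer_module_order _).
  + by rewrite /schreyer_order -Ys eqxx.
  + by rewrite /schreyer_order; case: eqP.
- move=> e; rewrite !tdeg_lift => /suph[-> // | -> | /supu[_ _ //]].
  by rewrite -Ys.
Qed.

(** The lift [X] of the leading monomial cancels in [comb g f], so a second symbol [s] contributes
    to [X]. Maximality of [(n, t)] gives [tie s t], and equality of the lifts makes [n] a multiple
    of the colon [x s : x t]. *)
Lemma schreyer_syzygy f a : syzygies f -> is_LM schreyer_order f a ->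
  exists r m, a = tmul m (x2 r).
Proof.
case: a => n t syzf [sf maxf].
set X := lift_term (n, t).
(* [X] bounds the lifts of all terms of [f], and [lift_term (m', s)] bounds the terms of the
   multiple of [g s]; hence only leading monomials reach [X]. *)
have lift_le m' s a' : m' \in msupp (f s : polyring K V) ->
    in_support (g s) a' -> tmul m' a' = X ->
    lift_term (m', s) = X /\ a' = x s.
  move=> m's sa' defX.
  have le1 : ord (lift_term (m', s)) X.
    by apply: schreyer_lift; apply: maxf.
  have le2 : ord X (lift_term (m', s)).
    by rewrite -defX; apply: (ord_tmul Hord); apply: (sb_LM sbg s).2.
  have eqX := ord_anti Hord le1 le2; split=> //.
  by apply: (@tmul_inj _ _ m'); rewrite defX -eqX.
have nzt : tcoef (fscale (f t) (g t)) X != 0.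
  rewrite tcoef_fscale => [|m' a' m't sa' eqX].
    by rewrite (sb_monic sbg) mulr1 -mcoeff_msupp.
  by have [eqm _] := lift_le m' t a' m't sa' eqX; apply: lift_inj eqm.
have [s neq_st] : exists2 s, s != t & tcoef (fscale (f s) (g s)) X != 0.
  apply: contrapT => none; case/eqP: nzt.
  have := congr1 (fun h => tcoef h X) syzf; rewrite /= tcoef_comb (bigD1 t) //=.
  rewrite big1 ?addr0 => [-> | s neq_st]; first by rewrite /tcoef ffunE mcoeff0.
  by apply: contrapT => /eqP nzs; apply: none; exists s.
rewrite -in_supportE => /in_support_fscale[m' [a' [m's sa' /esym defX]]].
have [eqX defa'] := lift_le m' s a' m's sa' defX.
have tie_st : tie s t.
  by have := maxf (m', s) m's; rewrite /schreyer_order eqX eqxx.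
have [r [r2 ler]] := colon_div (lift_component eqX) tie_st (elimN eqP neq_st).
exists r, (n - (x2 r).1)%MM; rewrite /tmul r2 submK //.
apply: lepm_trans ler _; apply/mnm_lepP=> i; rewrite !mnmE leq_subLR.
have := congr1 (fun a => (a.1 : monom V) i) eqX; rewrite /= !mnmDE => eqi.
by rewrite addnC -eqi leq_addl.
Qed.

Lemma schreyer_basis : exists g2 : T2 -> freemod K V T',
  standard_basis dg lift_deg schreyer_order syzygies g2 x2.
Proof.
have [g2 g2P] := choice s_pair.
exists g2; split=> [r|r|r|r|]; try by case: (g2P r).
exact: schreyer_syzygy.
Qed.

End Syzygies.

End Schreyer.

(** * The resolution *)

Section GroebnerConsequences.

Variables (K : fieldType) (V T T' : finType) (lev : rel V).
Variables (Z : zmodType) (dg : monom V -> Z) (d : T -> Z).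
Variables (ord : rel (mterm V T)) (M : freemod K V T -> Prop).
Variables (g : T' -> freemod K V T) (x : T' -> mterm V T).
Hypotheses (Hord : module_order lev ord) (sbg : standard_basis dg d ord M g x).

Lemma is_LM_unique (f : freemod K V T) a b :
  is_LM ord f a -> is_LM ord f b -> a = b.
Proof.
by move=> [sa maxa] [sb maxb]; apply: (ord_anti Hord); auto.
Qed.

Lemma mterm_elt_tmul m (a : mterm V T) :
  mterm_elt K (tmul m a) = ('X_[m] : polyring K V) *: mterm_elt K a.
Proof.
apply/ffunP=> t; rewrite !ffunE /=; case: eqP => _; first exact: mpolyXD.
by rewrite scaler0.
Qed.

Lemma standard_basis_groebner : is_groebner ord M (im_set g).
Proof.
have Mg f : im_set g f -> M f by case=> t <-; apply: (sb_mem sbg).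
split=> // h; split.
  apply: lin_span_sub (lin_span_submod _) _ _ => _ [f [a [gf LMa ->]]].
  rewrite -[mterm_elt _ _]scale1r; apply: lin_span_mem.
  by exists f, a; split=> //; apply: Mg.
apply: lin_span_sub (lin_span_submod _) _ _ => _ [f [a [Mf LMa ->]]].
have [t [m ->]] := sb_groebner sbg Mf LMa.
rewrite mterm_elt_tmul; apply: lin_span_mem.
by exists (g t), (x t); split=> //; [exists t | apply: (sb_LM sbg)].
Qed.

Hypothesis antichain : forall s t, mterm_dvd (x s) (x t) -> s = t.

Lemma standard_basis_inj : injective g.
Proof.
move=> s t eq_st; apply: antichain.
have LMt : is_LM ord (g s) (x t) by rewrite eq_st; apply: (sb_LM sbg t).
by rewrite (is_LM_unique (sb_LM sbg s) LMt) /mterm_dvd eqxx lepm_refl.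
Qed.

Lemma standard_basis_minimal : LM_minimal ord (im_set g).
Proof.
move=> _ _ a b [s <-] [t <-] neq_st LMa LMb; apply/negP=> dvd_ab.
apply: neq_st; congr (g _); apply: antichain.
by rewrite (is_LM_unique (sb_LM sbg s) LMa) (is_LM_unique (sb_LM sbg t) LMb).
Qed.

End GroebnerConsequences.

(** * Flags as symbols and their leading monomials *)

Section FlagTerms.

Variables (V : finType) (G : multigraph V) (q : V) (les : rel {set V}).
Hypothesis Hles : vertex_set_order q les.

Local Notation S k := (Sflag G q les k).

Definition flag_head k (U : S k) : {set V} := nth set0 (val U) 0.

Lemma min_flag_behead k (U : S k.+2) : min_flag G q les (behead_tuple (val U)).
Proof.
case: U => U /=; rewrite [U]tuple_eta => /(min_flag_cons G Hles)[_ _ + _].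
by congr (is_true (min_flag _ _ _ _)); apply: val_inj.
Qed.

Definition flag_tail k (U : S k.+2) : S k.+1 :=
  Sub (behead_tuple (val U)) (min_flag_behead U).

Lemma flag_eta k (U : S k.+2) :
  val U = [tuple of flag_head U :: val (flag_tail U)].
Proof.
by apply: val_inj; rewrite /flag_head /=; case/tupleP: (val U).
Qed.

Lemma min_flag_eta k (U : S k.+2) :
  min_flag G q les [tuple of flag_head U :: val (flag_tail U)].
Proof. by rewrite -flag_eta; apply: valP. Qed.

Lemma flag_inj k (U W : S k.+2) :
  flag_head U = flag_head W -> flag_tail U = flag_tail W -> U = W.
Proof.
by move=> eqh eqt; apply: val_inj; rewrite [LHS]flag_eta eqh eqt -flag_eta.
Qed.

Lemma flag_consP k (T : S k.+1) Z : min_flag G q les [tuple of Z :: val T] ->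
  exists U : S k.+2, flag_head U = Z /\ flag_tail U = T.
Proof.
by move=> minZ; exists (Sub _ minZ); split=> //; apply: val_inj; apply: val_inj.
Qed.

Lemma flag_headP k (U : S k.+2) : q \in flag_head U.
Proof. by case/(min_flag_cons G Hles): (min_flag_eta U). Qed.

Definition lead k (U : S k.+2) : mterm V (S k.+1) :=
  (mon_of_div (in_div G (val U)), flag_tail U).

Lemma expo_lead k (U : S k.+2) v :
  expo (lead U).1 v =
    cut_exp G (flag_head (flag_tail U) :\: flag_head U) (flag_head U) v.
Proof. by rewrite /lead /= flag_eta expo_cut_div. Qed.

Lemma lead_antichain k (U W : S k.+2) : mterm_dvd (lead U) (lead W) -> U = W.
Proof.
case/andP=> /eqP eqt /forallP leUW; apply: flag_inj => //.
have /(min_flag_cons G Hles)[qU stU _ _] := min_flag_eta U.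
have /(min_flag_cons G Hles)[qW stW _ _] := min_flag_eta W.
rewrite -[flag_tail W]eqt in stW.
apply: (cut_exp_le_eq qU qW stU stW) => v.
by have := leUW (enum_rank v); rewrite -!/(expo _ v) !expo_lead -[flag_tail W]eqt.
Qed.

(** The order is reversed: the flag whose head comes first in [les] gets the larger symbol, as the
    syzygy of [U] and a later [U'] has its leading monomial on [U]. *)
Definition flag_tie k : rel (S k.+2) :=
  fun U W => les (flag_head W) (flag_head U).

Lemma flag_tie_order k : tie_order (@lead k) (@flag_tie k).
Proof.
split=> [U W _ | U W eqt UW WU | X U W _ _ XU UW].
- by rewrite /flag_tie orbC (les_total Hles) ?flag_headP.
- by apply: flag_inj eqt; apply: (les_anti Hles) => //; apply: flag_headP.
- by apply: (les_trans Hles) UW XU; apply: flag_headP.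
Qed.

Lemma flag_colon_gen k (r : S k.+3) : exists s : S k.+2,
  [/\ same_component (@lead k) s (lead r).2, flag_tie s (lead r).2,
      s <> (lead r).2 & (lead r).1 = ((lead s).1 - (lead (lead r).2).1)%MM].
Proof.
pose t := flag_tail r; pose T := flag_tail t.
have minr : min_flag G q les
    [tuple of flag_head r :: [tuple of flag_head t :: val T]].
  by rewrite -flag_eta; apply: min_flag_eta.
have [U' [minU' lesU' neqU' eqU']] := colon_generator Hles minr.
have [s [eqh eqt]] := flag_consP minU'.
exists s; split=> //.
- by rewrite /flag_tie eqh.
- by move=> eq_st; apply: neqU'; rewrite -eqh eq_st.
apply: expo_inj => v; rewrite [RHS]/expo mnmBE -!/(expo _ v) !expo_lead.
by rewrite eqh eqt; apply: eqU'.
Qed.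

Lemma flag_colon_div k (s t : S k.+2) : same_component (@lead k) s t ->
  flag_tie s t -> s <> t ->
  exists r : S k.+3, (lead r).2 = t /\
    ((lead r).1 <= (lead s).1 - (lead t).1)%MM.
Proof.
move=> eqt tie_st neq_st.
have := min_flag_eta s; rewrite [flag_tail s]eqt => mins.
have neqh : flag_head t <> flag_head s.
  by move=> eqh; apply: neq_st; apply: flag_inj eqt.
have [Z minZ leZ] := colon_divisor Hles (min_flag_eta t) mins tie_st neqh.
rewrite -flag_eta in minZ; have [r [eqhr eqtr]] := flag_consP minZ.
exists r; split=> //; apply/mnm_lepP=> i; rewrite -(enum_valK i) mnmBE.
rewrite -!/(expo _ (enum_val i)) !expo_lead eqhr eqtr [flag_tail s]eqt.
exact: leZ.
Qed.

End FlagTerms.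

(** * Degrees and cancellation in the ideal *)

Section Degrees.

Variables (V : finType) (G : multigraph V) (A : grading).

Implicit Types m : monom V.

Lemma div_of_monD m1 m2 :
  div_of_mon (m1 + m2)%MM = div_of_mon m1 + div_of_mon m2.
Proof. by apply/ffunP=> v; rewrite !ffunE expoD. Qed.

Lemma div_of_monK (D : divisor V) :
  effective D -> div_of_mon (mon_of_div D) = D.
Proof.
move=> effD; apply/ffunP=> v; rewrite ffunE /expo mnmE enum_rankK.
exact: gez0_abs (effD v).
Qed.

Lemma deg_monD m1 m2 :
  deg_mon G A (m1 + m2)%MM = deg_mon G A m1 + deg_mon G A m2.
Proof.
rewrite /deg_mon div_of_monD; case: A => /=.
  by rewrite -big_split; apply: eq_bigr => v _; rewrite ffunE.
exact: (raddfD (\pi_(Quotient.quot (prin G : zmodClosed (divisor V))))%qT).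
Qed.

Lemma pic_deg_mon m1 m2 : pic G (div_of_mon m1) = pic G (div_of_mon m2) ->
  deg_mon G A m1 = deg_mon G A m2.
Proof.
rewrite /deg_mon => pic12; case: A => //=.
have eqd m : \sum_v div_of_mon m v = (mdeg m)%:Z.
  rewrite mdeg_expo (big_morph Posz PoszD (erefl _)).
  by apply: eq_bigr => v _; rewrite ffunE.
by rewrite !eqd (pic_mdeg pic12).
Qed.

Lemma pic_monD m m1 m2 : pic G (div_of_mon m1) = pic G (div_of_mon m2) ->
  pic G (div_of_mon (m + m1)%MM) = pic G (div_of_mon (m + m2)%MM).
Proof.
case/picP=> f eqf; apply/picP; exists f.
by rewrite !div_of_monD opprD addrACA subrr add0r.
Qed.

Variable K : fieldType.

(* The sum of the coefficients of an element of [I_G] over a class of [Pic(G)]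
   vanishes. *)
Lemma I_G_cancel (r : polyring K V) m : I_G G r -> m \in msupp r ->
  exists m', [/\ m' \in msupp r, m' <> m
    & pic G (div_of_mon m') = pic G (div_of_mon m)].
Proof.
pose cls m' := pic G (div_of_mon m') == pic G (div_of_mon m).
(* The degree bound makes the sum finite and loses nothing, since the monomials of a class of
   [Pic G] have equal degree. *)
pose phi (s : polyring K V) := \sum_(b : 'X_{1..#|V| < (mdeg m).+1} | cls b) s@_b.
have phi0 : phi 0 = 0 by apply: big1 => b _; rewrite mcoeff0.
have phiD s1 s2 : phi (s1 + s2) = phi s1 + phi s2.
  by rewrite -big_split; apply: eq_bigr => b _; rewrite mcoeffD.
have phiZ c s : phi (c *: s) = c * phi s.
  by rewrite mulr_sumr; apply: eq_bigr => b _; rewrite mcoeffZ.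
have phiX k : phi 'X_[k] = (cls k)%:R.
  have [clk | clk] := boolP (cls k).
    have ltk : (mdeg k < (mdeg m).+1)%N by rewrite ltnS (pic_mdeg (eqP clk)).
    rewrite /phi (bigD1 (BMultinom ltk)) //= mcoeffX eqxx big1 ?addr0 // => b.
    by case/andP=> _ neq_bk; rewrite mcoeffX eq_sym [_ == _](negPf neq_bk).
  apply: big1 => b clb; rewrite mcoeffX.
  by have [eq_kb | //] := eqVneq k b; rewrite eq_kb clb in clk.
move=> [s Ps ->]; set r' := \sum_(p <- s) _ => mr.
have phir : phi r' = 0.
  rewrite /r'; elim: s Ps {r' mr} => [|p s IHs] Ps; first by rewrite big_nil.
  rewrite big_cons phiD IHs ?addr0 => [|p' p's]; last first.
    by apply: Ps; rewrite inE p's orbT.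
  have [D1 [D2 [eff1 eff2 pic12 ->]]] := Ps p (mem_head _ _).
  rewrite -[LHS]/(phi ((p.1 : polyring K V) * (xdiv K D1 - xdiv K D2))).
  have {Ps IHs} -> : (p.1 : polyring K V) * (xdiv K D1 - xdiv K D2) =
      \sum_(k <- msupp p.1) p.1@_k *: ('X_[k + mon_of_div D1]
         - 'X_[k + mon_of_div D2]) :> polyring K V.
    rewrite {1}(mpolyE p.1) mulr_suml; apply: eq_bigr => k _.
    by rewrite -scalerAl mulrBr !mpolyXD.
  rewrite (big_morph phi phiD phi0) big1 // => k _.
  rewrite phiZ phiD -scaleN1r phiZ !phiX /cls (@pic_monD _ _ (mon_of_div D2)).
    by rewrite mulN1r subrr mulr0.
  by rewrite !div_of_monK.
apply: contrapT => none; move: mr; rewrite mcoeff_msupp => /eqP; apply.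
have ltm : (mdeg m < (mdeg m).+1)%N by [].
move: phir; rewrite /phi (bigD1 (BMultinom ltm)) /=; last exact: eqxx.
rewrite big1 ?addr0 // => b /andP[clb neq_bm].
apply/eqP; rewrite mcoeff_eq0; apply/negP=> br; apply: none.
exists (b : monom V); split=> //; last exact/eqP.
by move=> eq_bm; case/eqP: neq_bm; apply: val_inj.
Qed.

End Degrees.

Section Resolution.

Variables (K : fieldType) (V : finType) (G : multigraph V) (q : V).
Variables (A : grading) (lev : rel V) (les : rel {set V}).
Hypotheses (Hlev : variable_order G q lev) (Hles : vertex_set_order q les).

Local Notation S k := (Sflag G q les k).
Local Notation F k := (Fmod K V G q les k).

Lemma Sflag1_all (U W : S 1) : U = W.
Proof.
have valT (X : S 1) : val X = [tuple of [:: setT]].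
  case: X => X /= /andP[/is_flagP[_ _ _ lastX] _]; apply: val_inj => /=.
  by case/tupleP: X lastX => B X /= ->; rewrite tuple0.
by apply: val_inj; rewrite !valT.
Qed.

Lemma min_flag_setT : min_flag G q les [tuple of [:: setT]].
Proof.
apply/(min_flagP G Hles); split=> [|i j _]; last by rewrite ltnS ltn0.
by rewrite /is_flag /= inE eqxx.
Qed.

Fixpoint flag_ord k : rel (mterm V (S k.+1)) :=
  match k return rel (mterm V (S k.+1)) with
  | 0 => fun a b => degrevlex lev a.1 b.1
  | k'.+1 => schreyer_order (@flag_ord k') (lead Hles (k := k'))
      (@flag_tie V G q les k')
  end.

Lemma flag_ord_module k : module_order lev (@flag_ord k).
Proof.
elim: k => [|k IHk]; last first.
  exact: (schreyer_module_order IHk (flag_tie_order G Hles k)).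
split=> //=.
- by move=> a b; apply: (degrevlex_total Hlev).
- move=> [m1 t1] [m2 t2] /= /(degrevlex_anti Hlev) ->.
  by rewrite (Sflag1_all t1 t2).
- by move=> b a c; apply: (degrevlex_trans Hlev).
- by move=> m m1 m2 _ _; apply: degrevlex_add.
Qed.

Lemma flag_ord_finite k : finite_below (@flag_ord k).
Proof.
elim: k => [a|k IHk]; last exact: (schreyer_finite (flag_ord_module k) IHk).
have [s sP] := degrevlex_finite lev a.1.
exists [seq (m, t) | m <- s, t <- enum (S 1)] => -[m t] /sP m_s.
by apply/allpairsP; exists (m, t); rewrite mem_enum.
Qed.

(** Computed from [lead] alone, hence available before the maps psi; [symbol_deg_flag] identifies it
    with [symbol_deg]. *)
Fixpoint flag_deg k : S k.+1 -> grading_group G A :=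
  match k return S k.+1 -> grading_group G A with
  | 0 => fun=> 0
  | k'.+1 => lift_deg (deg_mon G A) (@flag_deg k') (lead Hles (k := k'))
  end.

Definition flag_basis k (M : F k -> Prop) (g : S k.+2 -> F k) : Prop :=
  is_submod M /\
  standard_basis (deg_mon G A) (@flag_deg k) (@flag_ord k) M g
    (lead Hles (k := k)).

Definition psi0 (U : S 2) : F 0 :=
  in_F0 G q les (xdiv K (in_div G (val U)) - xdiv K (out_div G (val U))).

Definition syz0 (f : F 0) : Prop :=
  exists2 r, I_G G r & f = in_F0 G q les r.

Lemma in_support_F0 (r : polyring K V) a :
  in_support (in_F0 G q les r) a = (a.1 \in msupp r).
Proof. by rewrite /in_support ffunE. Qed.

Lemma flag_basis0 : flag_basis syz0 psi0.
Proof.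
split.
  split=> [|p f h [r Ir ->] [s Is ->]].
    exists 0; first by exists [::]; rewrite ?big_nil.
    by apply/ffunP=> t; rewrite !ffunE.
  exists (p * r + s); last by apply/ffunP=> t; rewrite !ffunE.
  exact: (lin_span_submod _).2.
pose U1 (U : S 2) := flag_head U.
have val2 (U : S 2) : val U = [tuple of [:: U1 U; setT]].
  rewrite [LHS](flag_eta Hles).
  rewrite (Sflag1_all (flag_tail Hles U) (Sub _ min_flag_setT)).
  exact: val_inj.
have out_expo (U : S 2) v :
    expo (mon_of_div (out_div G (val U))) v = cut_exp G (U1 U) (~: U1 U) v.
  by rewrite expo_cut_div val2 /= setTD.
have in_expo (U : S 2) v :
    expo (mon_of_div (in_div G (val U))) v = cut_exp G (~: U1 U) (U1 U) v.
  by rewrite expo_cut_div val2 /= setTD.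
have lapU (U : S 2) : div_of_mon (mon_of_div (out_div G (val U))) -
    div_of_mon (mon_of_div (in_div G (val U))) =
    laplacian G (fun w => (w \in U1 U)%:Z).
  by apply/ffunP=> v; rewrite laplacian_cut !ffunE out_expo in_expo.
have pic_io (U : S 2) : pic G (div_of_mon (mon_of_div (out_div G (val U)))) =
    pic G (div_of_mon (mon_of_div (in_div G (val U)))).
  by apply/picP; eexists; apply: lapU.
have qU (U : S 2) : q \in U1 U by apply: flag_headP.
have neq_io (U : S 2) :
    mon_of_div (in_div G (val U)) != mon_of_div (out_div G (val U)).
  have /(min_flag_cons G Hles)[_ /and3P[prU _ _] _ _] := min_flag_eta Hles U.
  have {}prU : U1 U \proper setT.
    by move: prU; rewrite (Sflag1_all (flag_tail Hles U) (Sub _ min_flag_setT)).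
  have [|x [y [xU yU xy]]] := connected_exit (connected_setT G) _ prU.
    by apply/set0Pn; exists q.
  apply/eqP=> /(congr1 (fun m => expo m y)); rewrite in_expo out_expo /cut_exp.
  have /andP[yU' _] : (y \notin U1 U) && (y \in [set: V]) by rewrite -in_setD.
  rewrite in_setC yU' (negPf yU') => eq0.
  by have := edges_to_gt0 xU (etrans (adj_sym G y x) xy); rewrite eq0.
have supp0 U a : in_support (psi0 U) a ->
    a = lead Hles U \/ a = (mon_of_div (out_div G (val U)), flag_tail Hles U).
  case: a => m t; rewrite in_support_F0 => /msuppB_le /=.
  rewrite mem_cat !msuppX !inE (Sflag1_all t (flag_tail Hles U)).
  by case/orP=> /eqP->; [left | right].
have coef0 U : tcoef (psi0 U) (lead Hles U) = 1.
  rewrite /tcoef ffunE mcoeffB !mcoeffX eqxx [_ == mon_of_div (in_div _ _)]eq_sym.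
  by rewrite (negPf (neq_io U)) subr0.
split=> //.
- move=> U; exists (xdiv K (in_div G (val U)) - xdiv K (out_div G (val U))) => //.
  rewrite -[X in I_G _ X]mul1r; apply: (@lin_span_mem _ (polyring K V)^o).
  exists (in_div G (val U)), (out_div G (val U)); split=> //.
  + by move=> v; rewrite ffunE; case: ifP.
  + by move=> v; rewrite ffunE; case: ifP.
  + by have := pic_io U; rewrite !div_of_monK // => v; rewrite ffunE; case: ifP.
- move=> U; split; first by rewrite in_supportE coef0 oner_eq0.
  move=> a /supp0[-> | ->] /=; first by rewrite /degrevlex eqxx.
  (* The indicator of [U1 U] is maximal at [q], and its Laplacian is [out_div] minus [in_div]; so
     [in_div] is not the smaller monomial. *)
  have maxq v : (v \in U1 U)%:Z <= (q \in U1 U)%:Z :> int.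
    by rewrite qU; case: (v \in _).
  have nlt := fire_from_q Hlev (lapU U) maxq.
  have := degrevlex_lt_total Hlev (neq_io U).
  by rewrite (negPf nlt) /= /degrevlex => ->; rewrite orbT.
- move=> U a /supp0[-> | ->] //.
  by rewrite /tdeg; congr (_ + _); apply: pic_deg_mon; apply: pic_io.
move=> _ [m t] [r Ir ->] [mr maxm]; rewrite in_support_F0 in mr.
(* The leading monomial is equivalent to a smaller one. The function relating them is therefore not
   maximal at [q], and burning gives a cut whose leading monomial divides [m]. *)
have [m' [m'r neq_m'm /esym pic_m']] := I_G_cancel Ir mr.
have lt_m'm : degrevlex_lt lev m' m.
  have := maxm (m', t); rewrite in_support_F0 => /(_ m'r) /=.
  by case/predU1P.
have [f eqf] := (picP _ _ _).1 pic_m'.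
have nmax : ~ (forall v, (f v <= f q)%R).
  by move=> /(fire_from_q Hlev eqf); rewrite lt_m'm.
have [U [qU' stU leU]] := fire_cut eqf nmax.
(* With a single layer above [U] there is no exchange to test. *)
have minU : min_flag G q les [tuple of U :: [tuple of [:: setT]]].
  by apply/(min_flag_cons G Hles); split=> //; exact: min_flag_setT.
have [W [eqW _]] := flag_consP Hles (T := Sub _ min_flag_setT) minU.
exists W, (m - mon_of_div (in_div G (val W)))%MM.
rewrite /tmul /= (Sflag1_all t (flag_tail Hles W)) submK //.
apply/mnm_lepP=> i; rewrite -(enum_valK i) -!/(expo _ (enum_val i)) in_expo.
by rewrite /U1 eqW -setTD; apply: leU.
Qed.

Lemma flag_basisS k M g : flag_basis M g ->
  exists g', flag_basis (k := k.+1) (fun f => \sum_U f U *: g U = 0) g'.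
Proof.
case=> subM sbg.
have -> : (fun f : F k.+1 => \sum_U f U *: g U = 0) = syzygies g.
  by rewrite /syzygies comb.unlock.
have [g2 sb2] := schreyer_basis (@deg_monD _ G A) (flag_ord_module k)
  (@flag_ord_finite k) subM sbg (flag_tie_order G Hles k)
  (@flag_colon_gen _ G q les Hles k) (@flag_colon_div _ G q les Hles k).
exists g2; split=> //; split=> [|p u v syzu syzv]; first exact: comb0.
by rewrite /syzygies combD combZ syzu syzv scaler0 addr0.
Qed.

(** Each syzygy module depends on the map chosen one level below, so the levels cannot be chosen
    independently. A stage packs a submodule with a basis of it, and [step] also returns the
    equation tying the next submodule to the current basis. *)
Lemma psi_exists : exists psi : psi_family K G q les,
  psi 0%N = psi0 /\ forall k, flag_basis (syz psi (k := k)) (psi k).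
Proof.
pose stage k := {p : (F k -> Prop) * (S k.+2 -> F k) | flag_basis p.1 p.2}.
have step k (s : stage k) :
    {s' : stage k.+1 | (sval s').1 = fun f => \sum_U f U *: (sval s).2 U = 0}.
  apply: cid; have [g' fbg'] := flag_basisS (svalP s).
  by exists (exist _ (_, g') fbg').
pose st : forall k, stage k :=
  nat_rect stage (exist _ (syz0, psi0) flag_basis0) (fun k s => sval (step k s)).
pose psi : psi_family K G q les := fun k => (sval (st k)).2.
exists psi; split=> // k.
have -> : syz psi (k := k) = (sval (st k)).1.
  by case: k => [|k] //; rewrite /= (svalP (step k (st k))).
exact: (svalP (st k)).
Qed.

(** [deg_elt] reads the degree off whichever nonzero component is picked; by homogeneity it is the
    degree of the leading monomial. *)
Lemma symbol_deg_flag (psi : psi_family K G q les) :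
  (forall k, flag_basis (syz psi (k := k)) (psi k)) ->
  forall k, symbol_deg A psi (k := k) = @flag_deg k.
Proof.
move=> fb; elim=> [|k IHk] //=; apply/funext => U; rewrite IHk.
have [_ sbk] := fb k; have hom := sb_homog sbk (t := U).
rewrite /deg_elt; case: pickP => [t nz_t | z].
  by apply: (hom (_, t)); apply: mlead_supp.
have [] := sb_LM sbk U; rewrite /in_support.
have /negbFE/eqP-> := z (lead Hles U).2.
by rewrite msupp0.
Qed.

End Resolution.

Theorem theorem5p3 (K : fieldType) (V : finType) (G : multigraph V) (q : V)
    (A : grading) (lev : rel V) (les : rel {set V})
    (Hlev : variable_order G q lev) (Hles : vertex_set_order q les) :
  exists psi : psi_family K G q les,
    (forall f, im_set (psi 0%N) f <->
       exists2 r, cut_binomials G q les r & f = in_F0 G q les r) /\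
    forall k : nat,
      [/\ injective (psi k),
          forall U, syz psi (psi k U)
        & exists ord : rel (mterm V (Sflag G q les k.+1)),
          [/\ module_order lev ord,
              k = 0%N -> forall m1 m2 U1 U2,
                ord (m1, U1) (m2, U2) = degrevlex lev m1 m2,
              [/\ is_groebner ord (@syz K V G q les psi k) (im_set (psi k)),
                  LM_minimal ord (im_set (psi k))
                & forall f, im_set (psi k) f ->
                    homogeneous (symbol_deg A psi (k := k)) f]
            & forall U : Sflag G q les k.+2,
                exists2 W : Sflag G q les k.+1,
                  val W = behead_tuple (val U)
                  & is_LM ord (psi k U) (mon_of_div (in_div G (val U)), W)]].
Proof.
have [psi [psi0E fb]] := psi_exists K A Hlev Hles.
exists psi; split.
  move=> f; rewrite psi0E; split; first by case=> U <-; eexists; [exists U |].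
  by case=> _ [U ->] ->; exists U.
move=> k; have [_ sbk] := fb k.
have ordk := flag_ord_module Hlev Hles k.
have antichain := @lead_antichain _ G q les Hles k.
split; first exact: (standard_basis_inj ordk sbk antichain).
  exact: (sb_mem sbk).
exists (@flag_ord _ G q lev les Hles k); split=> //.
- by move=> k0; subst k.
- split; first exact: (standard_basis_groebner sbk).
    exact: (standard_basis_minimal ordk sbk antichain).
  move=> _ [U <-].
  exists (tdeg (deg_mon G A) (flag_deg A Hles (k := k)) (lead Hles U)).
  by rewrite (symbol_deg_flag fb) => a; apply: (sb_homog sbk).
- by move=> U; exists (flag_tail Hles U); [| apply: (sb_LM sbk)].
Qed.
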